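(* Assume the standing hypotheses below. Let $t_{\min}$ be a greatest common divisor of $f_{\min}$ and $g_{\min}$ in $R$, and $t_{\max}$ a greatest common divisor of $f_{\max}$ and $g_{\max}$ in $R$. Then $t_{\min}\in\mathfrak p$ and $t_{\max}\in\mathfrak p$.
   Context: Let $k$ be an algebraically closed field of characteristic zero, $R=k[w,x,y,z]$, and let $\mathfrak p\subseteq R$ be the homogeneous prime ideal of Macaulay's curve $C_4\subseteq\mathbb P^3_k$, the curve with parametrization $[s^4:s^3t:st^3:t^4]$. Endow $R$ with the bigrading $\deg w=(4,0)$, $\deg x=(3,1)$, $\deg y=(1,3)$, $\deg z=(0,4)$; $\mathfrak p$ is bihomogeneous. Standing hypothesis: $f,g\in\mathfrak p$ are homogeneous (in the usual grading) of degrees $d_1,d_2$ with $\sqrt{(f,g)R}=\mathfrak p$. Write $f=\sum_{i=i_{\min}}^{i_{\max}} f^{(i,4d_1-i)}$ and $g=\sum_{j=j_{\min}}^{j_{\max}} g^{(j,4d_2-j)}$ as sums of bihomogeneous components, where $f^{(i,4d_1-i)}$ is the component of bidegree $(i,4d_1-i)$ and $i_{\min},i_{\max},j_{\min},j_{\max}$ are chosen so that $f_{\min}:=f^{(i_{\min},4d_1-i_{\min})}$, $f_{\max}:=f^{(i_{\max},4d_1-i_{\max})}$, $g_{\min}:=g^{(j_{\min},4d_2-j_{\min})}$, $g_{\max}:=g^{(j_{\max},4d_2-j_{\max})}$ are all nonzero. *)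

(* Defs.v *)
(* R = k[w,x,y,z] is encoded as nested univariate polynomials
   {poly {poly {poly {poly k}}}}: outermost variable w, then x, y, innermost z.
   The coefficient of w^a x^b y^c z^d in P is  P`_a`_b`_c`_d. *)
From HB Require Import structures.
From mathcomp Require Import all_boot all_order all_algebra.
Set Implicit Arguments. Unset Strict Implicit. Unset Printing Implicit Defensive.
Import Order.TTheory GRing.Theory.
Local Open Scope ring_scope.

Definition R4 (k : nzRingType) := {poly {poly {poly {poly k}}}}.

Definition coef4 {k : nzRingType} (P : R4 k) (a b c d : nat) : k :=
  P`_a`_b`_c`_d.

Definition homog {k : nzRingType} (n : nat) (P : R4 k) : Prop :=
  forall a b c d, coef4 P a b c d != 0 -> (a + b + c + d)%N = n.

(* first coordinate of the bidegree of w^a x^b y^c z^d :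
   deg w = (4,0), deg x = (3,1), deg y = (1,3), deg z = (0,4) *)
Definition bideg1 (a b c d : nat) : nat := (4 * a + 3 * b + c)%N.
Definition bideg2 (a b c d : nat) : nat := (b + 3 * c + 4 * d)%N.

Definition bicomp {k : nzRingType} (i j : nat) (P : R4 k) : R4 k :=
  \poly_(a < size P) \poly_(b < size P`_a) \poly_(c < size P`_a`_b)
   \poly_(d < size P`_a`_b`_c)
     (if (bideg1 a b c d == i) && (bideg2 a b c d == j) then P`_a`_b`_c`_d else 0).

(* k[s,t] encoded as {poly {poly k}}: outer variable s, inner variable t. *)
Definition monoST {k : nzRingType} (e1 e2 : nat) : {poly {poly k}} :=
  ('X^e2)%:P * 'X^e1.

(* the parametrization map R -> k[s,t]:
   w |-> s^4, x |-> s^3 t, y |-> s t^3, z |-> t^4 *)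
Definition param {k : nzRingType} (P : R4 k) : {poly {poly k}} :=
  \sum_(a < size P) \sum_(b < size P`_a) \sum_(c < size P`_a`_b)
   \sum_(d < size P`_a`_b`_c)
     (P`_a`_b`_c`_d)%:P%:P * monoST (bideg1 a b c d) (bideg2 a b c d).

(* the prime ideal p of Macaulay's curve C_4 : kernel of the parametrization *)
Definition in_p {k : nzRingType} (P : R4 k) : Prop := param P = 0.

Definition dvdR {k : comNzRingType} (u v : R4 k) : Prop := exists q : R4 k, v = u * q.

Definition is_gcdR {k : comNzRingType} (t f g : R4 k) : Prop :=
  [/\ dvdR t f, dvdR t g & forall u, dvdR u f -> dvdR u g -> dvdR u t].

Definition in_ideal2 {k : comNzRingType} (f g h : R4 k) : Prop :=
  exists a b : R4 k, h = a * f + b * g.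

Definition radical_eq_p {k : comNzRingType} (f g : R4 k) : Prop :=
  forall h : R4 k, (exists n : nat, in_ideal2 f g (h ^+ n)) <-> in_p h.

(* i is the least / greatest first bidegree index of a nonzero bihomogeneous
   component of P, where P is homogeneous of degree n (so components are of
   bidegree (i, 4n - i)). *)
Definition is_imin {k : nzRingType} (n : nat) (P : R4 k) (i : nat) : Prop :=
  bicomp i (4 * n - i) P != 0 /\
  forall i', bicomp i' (4 * n - i') P != 0 -> (i <= i')%N.
Definition is_imax {k : nzRingType} (n : nat) (P : R4 k) (i : nat) : Prop :=
  bicomp i (4 * n - i) P != 0 /\
  forall i', bicomp i' (4 * n - i') P != 0 -> (i' <= i)%N.

(* Main.v *)
Require Import Defs.
From HB Require Import structures.
From mathcomp Require Import all_boot all_order all_algebra.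
From mathcomp Require Import ring zify.
From Stdlib Require Import Classical.
Set Implicit Arguments. Unset Strict Implicit. Unset Printing Implicit Defensive.
Import GRing.Theory.
Local Open Scope ring_scope.

(** Let F, G be the extremal bihomogeneous parts of f, g, let t be their gcd, F = t a and
    G = t b, and suppose that t is not in p; let tau be the degree of t.

    The extremal forms of elements of (f,g) span an ideal I with the Hilbert function of
    R/(f,g), whose growth is at least d1 d2 D. I contains t a, t b and powers of all
    bihomogeneous elements of p; as t is invertible modulo p up to a monomial in w and z,
    the Hilbert function of R/I exceeds that of R/(a,b), shifted by tau, by at most a
    constant. Since a and b are coprime, the latter grows like (d1 - tau) (d2 - tau) D.
    Hence tau = 0.

    So F and G are coprime, and therefore generate I; in particular powers of x^4 - w^3 z,
    y^4 - w z^3 and xy - wz lie in (F,G). Modulo (w,z) the forms F, G must then be, up to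
    scalars and order, x^n and y^m, and bihomogeneity leaves in F(1,x,y,1) and G(1,x,y,1),
    besides x^n and y^m, only terms of degree at most n - 2 and m - 2. The quotient of
    k[x,y] by these two polynomials has the basis x^i y^j (i < n, j < m), in which
    multiplication by xy has zero diagonal. But xy - 1 is nilpotent there, so the trace of
    xy is also n m, which is nonzero in characteristic 0. *)

(** * Factorial rings *)

Definition divides (A : comNzRingType) (a b : A) : Prop := exists q, b = a * q.

Definition prime_elt (A : idomainType) (p : A) : Prop :=
  [/\ p != 0, p \isn't a GRing.unit &
      forall a b, divides p (a * b) -> divides p a \/ divides p b].

(* The index is the number of prime factors, a measure for stripping them off. *)
Inductive factored (A : idomainType) : nat -> A -> Prop :=
| factored_unit u : u \is a GRing.unit -> factored 0 u
| factored_prime n p a : prime_elt p -> factored n a -> factored n.+1 (p * a).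

Definition factorial_ring (A : idomainType) : Prop :=
  forall a : A, a != 0 -> exists n, factored n a.

Lemma factored_unitl (A : idomainType) n (u a : A) :
  u \is a GRing.unit -> factored n a -> factored n (u * a).
Proof.
move=> uu; elim=> [v uv|{}n p {}a pp fa IH]; first by left; rewrite unitrM uu.
by rewrite mulrCA; right.
Qed.

Lemma factored_mul (A : idomainType) m n (a b : A) :
  factored m a -> factored n b -> factored (m + n) (a * b).
Proof.
move=> fa fb; elim: fa => [u uu|{}m p {}a pp fa IH].
  by rewrite add0n; apply: factored_unitl.
by rewrite -mulrA addSn; right.
Qed.

Lemma factored_div_prime_gt0 (A : idomainType) n (l p m : A) :
  factored n l -> prime_elt p -> l = p * m -> exists n', n = n'.+1.
Proof.
case=> [u uu [_ pnu _] e|{}n q a pq fa _ _]; last by exists n.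
by case/negP: pnu; move: uu; rewrite e unitrM => /andP[].
Qed.

(** Compare [p] with the first prime [q] of the factorization of [l]. If [p] divides [q], the two
    are associate and [m] is the rest up to a unit; otherwise [p] divides the rest and induction
    applies. *)
Lemma factored_div_prime (A : idomainType) n (l p m : A) :
  factored n.+1 l -> prime_elt p -> l = p * m -> factored n m.
Proof.
move=> fl pp; move E : n.+1 fl => n1 fl; elim: fl n m E => // {}n1 q a pq fa IH n m [En].
subst n1; move: (pp) => [p0 pnu ppr] e.
have [[v ev]|[v ev]] : divides p q \/ divides p a.
  by apply: ppr; exists m.
- have [q0 qnu qpr] := pq.
  have uv : v \is a GRing.unit.
    have [[c ec]|[c ec]] : divides q p \/ divides q v.
      by apply: qpr; exists 1; rewrite mulr1.
      move: ev; rewrite ec -mulrA => /eqP; rewrite -{1}[q]mulr1.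
      rewrite (inj_eq (mulfI q0)) => /eqP e1.
      by apply/unitrPr; exists c; rewrite mulrC -e1.
    move: ev; rewrite ec mulrCA => /eqP; rewrite -{1}[q]mulr1 (inj_eq (mulfI q0)) => /eqP e1.
    by case/negP: pnu; apply/unitrPr; exists c.
  have -> : m = v * a.
    by apply: (mulfI p0); rewrite -e ev; ring.
  exact: factored_unitl.
- have em : m = q * v by apply: (mulfI p0); rewrite -e ev; ring.
  case: n fa IH e => [|n] fa IH e.
    by have [] := factored_div_prime_gt0 fa pp ev.
  by rewrite em; right => //; apply: IH ev.
Qed.

Lemma divides_polyC (A : comNzRingType) (p : A) (P : {poly A}) :
  divides p%:P P <-> forall i, divides p P`_i.
Proof.
split=> [[Q ->] i|]; first by exists Q`_i; rewrite coefCM.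
elim/poly_ind: P => [_|P c IH H]; first by exists 0; rewrite mulr0.
have [Q eQ] : divides p%:P P.
  by apply: IH => i; have := H i.+1; rewrite coefD coefMX coefC /= addr0.
have [q eq] : divides p c by have := H 0%N; rewrite coefD coefMX coefC /= add0r.
by exists (Q * 'X + q%:P); rewrite mulrDr mulrA -eQ -polyCM -eq.
Qed.

(** Gauss's lemma, by induction on the sum of the sizes: [p] divides the product of the constant
    terms, hence one of them; that term is subtracted from its factor and the remainder divided by
    X. *)
Lemma prime_elt_polyC (A : idomainType) (p : A) :
  prime_elt p -> prime_elt (p%:P : {poly A}).
Proof.
move=> [p0 pnu pp]; split; first by rewrite polyC_eq0.
  by rewrite poly_unitE coefC /= negb_and pnu orbT.
have stripX (P : {poly A}) (c : A) : divides p c -> divides p%:P P ->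
    divides p%:P (P * 'X + c%:P).
  move=> [q ->] [Q ->]; exists (Q * 'X + q%:P).
  by rewrite mulrDr mulrA polyCM.
have dX (P : {poly A}) : divides p%:P (P * 'X) -> divides p%:P P.
  move/divides_polyC=> H; apply/divides_polyC => i.
  by have := H i.+1; rewrite coefMX.
have polydec (P : {poly A}) : exists P1 c, P = P1 * 'X + c%:P /\
    (size P1 <= (size P).-1)%N.
  elim/poly_ind: P => [|P c _].
    by exists 0, 0; rewrite size_poly0 mul0r add0r polyC0.
  exists P, c; split=> //; rewrite size_MXaddC.
  by case: ifP => [/andP[/eqP-> _]|_] //; rewrite size_poly0.
move=> P Q; have [n] := ubnP (size P + size Q); elim: n P Q => // n IH P Q.
have [->|P0] := eqVneq P 0; first by left; exists 0; rewrite mulr0.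
have [->|Q0] := eqVneq Q 0; first by right; exists 0; rewrite mulr0.
have sP := size_poly_gt0 P; have sQ := size_poly_gt0 Q.
rewrite P0 in sP; rewrite Q0 in sQ => hn.
have [P1 [a [eP sP1]]] := polydec P; have [Q1 [b [eQ sQ1]]] := polydec Q.
move=> dPQ.
have /pp dab : divides p (a * b).
  move/divides_polyC: dPQ => /(_ 0%N).
  by rewrite eP eQ coefM big_ord1 !(coefD, coefMX, coefC) /= !add0r.
case: dab => [da|db].
- have dP1 : divides p%:P (P1 * Q).
    apply: dX; have -> : P1 * Q * 'X = P * Q - a%:P * Q by rewrite eP; ring.
    case: dPQ => u ->; case: da => v ->; exists (u - v%:P * Q).
    by rewrite polyCM; ring.
  have [|dP|] := IH P1 Q _ dP1; [by lia| |by right].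
  by left; rewrite eP; apply: stripX.
- have dQ1 : divides p%:P (P * Q1).
    apply: dX; have -> : P * Q1 * 'X = P * Q - b%:P * P by rewrite eQ; ring.
    case: dPQ => u ->; case: db => v ->; exists (u - v%:P * P).
    by rewrite polyCM; ring.
  have [||dQ] := IH P Q1 _ dQ1; [by lia|by left|].
  by right; rewrite eQ; apply: stripX.
Qed.

Lemma factored_polyC (A : idomainType) n (a : A) :
  factored n a -> factored n (a%:P : {poly A}).
Proof.
elim=> [u uu|{}n p {}a pp fa IH]; last by rewrite polyCM; right => //; apply: prime_elt_polyC.
have u0 : u != 0 by apply: contraTneq uu => ->; rewrite unitr0.
by left; rewrite poly_unitE coefC uu size_polyC u0.
Qed.

(** By Gauss's lemma each prime of [c] divides [Q] or [S], and dividing it out keeps the sizes. This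
    turns a factorization over the fraction field into one over [A]. *)
Lemma cancel_constant (A : idomainType) n (c : A) (P Q S : {poly A}) :
  factored n c -> c%:P * P = Q * S ->
  exists Q' S', [/\ P = Q' * S', size Q' = size Q & size S' = size S].
Proof.
move=> fc; elim: fc Q S => [u uu|{}n p a pp fa IH] Q S e.
  exists (u^-1%:P * Q), S; split=> //.
    by rewrite -mulrA -e mulrA -polyCM mulVr // mul1r.
  by rewrite mul_polyC size_scale // invr_eq0; apply: contraTneq uu => ->; rewrite unitr0.
have [p0 _ _] := pp; have [P0 _ pP] := prime_elt_polyC pp.
have [[Q1 eQ]|[S1 eS]] : divides p%:P Q \/ divides p%:P S.
  by apply: pP; exists (a%:P * P); rewrite -e polyCM mulrA.
- have [|Q' [S' [-> sQ sS]]] := IH Q1 S.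
    by apply: (mulfI P0); rewrite mulrA -polyCM e eQ mulrA.
  by exists Q', S'; split=> //; rewrite sQ eQ mul_polyC size_scale.
- have [|Q' [S' [-> sQ sS]]] := IH Q S1.
    by apply: (mulfI P0); rewrite mulrA -polyCM e eS; ring.
  by exists Q', S'; split=> //; rewrite sS eS mul_polyC size_scale.
Qed.

(** As no prime divides [P], Gauss's lemma pushes every prime of [c] into the cofactor [H]. *)
Lemma cancel_primitive (A : idomainType) n (c : A) (P Q H : {poly A}) :
  (forall p : A, prime_elt p -> ~ divides p%:P P) ->
  factored n c -> c%:P * Q = P * H -> divides P Q.
Proof.
move=> prim fc; elim: fc H => [u uu|{}n p a pp fa IH] H e.
  exists (u^-1%:P * H).
  by rewrite mulrCA -e mulrA -polyCM mulVr // mul1r.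
have [P0 _ pP] := prime_elt_polyC pp.
have [/(prim _ pp)//|[H1 eH]] : divides p%:P P \/ divides p%:P H.
  by apply: pP; exists (a%:P * Q); rewrite -e polyCM mulrA.
by apply: (IH H1); apply: (mulfI P0); rewrite mulrA -polyCM e eH; ring.
Qed.

(** The gcd of [P] and [Q] exists up to constants, by pseudo-division, and its degree is that of a
    factor of [P]. Irreducibility leaves two cases: the gcd is constant and [P] divides [S], or it
    is [P] up to constants and [P] divides [Q]. *)
Lemma primitive_irreducible_prime (A : idomainType) (P : {poly A}) :
  factorial_ring A -> (1 < size P)%N ->
  (forall p : A, prime_elt p -> ~ divides p%:P P) ->
  (forall Q S, P = Q * S -> (size Q <= 1)%N \/ (size S <= 1)%N) ->
  prime_elt P.
Proof.
move=> fact sP prim irr.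
have P0 : P != 0 by rewrite -size_poly_gt0; lia.
(* For primitive [P], divisibility up to a constant is genuine divisibility. *)
have pseudo Q : P %| Q -> divides P Q.
  case/Pdiv.WeakIdomain.dvdpP => -[c H] /= c0 e.
  have [n fc] := fact _ c0.
  by apply: (cancel_primitive (c := c) (H := H) prim fc); rewrite mul_polyC e mulrC.
split=> //; first by rewrite poly_unitE; apply/negP => /andP[/eqP e]; rewrite e in sP.
move=> Q S [H e].
have /Pdiv.WeakIdomain.dvdpP[[c r] /= c0 ecr] := dvdp_gcdl P Q.
have [n fc] := fact _ c0.
have [|Q' [S' [eP sQ sS]]] := @cancel_constant _ n c P (gcdp P Q) r fc.
  by rewrite mul_polyC ecr mulrC.
have g0 : gcdp P Q != 0 by rewrite gcdp_eq0 negb_and P0.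
have [sg|sr] := irr _ _ eP.
- right; apply: pseudo; rewrite -(@Gauss_dvdpr _ _ Q); last first.
    by rewrite coprimep_def eqn_leq size_poly_gt0 g0 andbT -sQ.
  by apply/Pdiv.WeakIdomain.dvdpP; exists (1, H) => /=; rewrite ?oner_neq0 // scale1r e mulrC.
- left; apply: pseudo; apply: dvdp_trans (dvdp_gcdr P Q).
  have /size1_polyC er : (size r <= 1)%N by rewrite -sS.
  apply/Pdiv.WeakIdomain.dvdpP; exists (r`_0, c%:P) => /=.
    apply: contraTneq c0 => r0; rewrite er r0 polyC0 mul0r in ecr.
    by move/eqP: ecr; rewrite -mul_polyC mulf_eq0 polyC_eq0 (negbTE P0) orbF negbK.
  by rewrite mul_polyC ecr {2}er mul_polyC.
Qed.

(** A splitting into factors of positive degree lowers the size. Without one, prime constants are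
    divided out until the polynomial is primitive, hence prime. *)
Lemma factorial_ring_poly (A : idomainType) :
  factorial_ring A -> factorial_ring ({poly A} : idomainType).
Proof.
move=> fact P; have [n] := ubnP (size P); elim: n P => // n IH P sPn P0.
have [sP|sP] := leqP (size P) 1.
  have /fact[m fm] : P`_0 != 0 by move: P0; rewrite {1}(size1_polyC sP) polyC_eq0.
  by exists m; rewrite (size1_polyC sP); apply: factored_polyC.
case: (classic (exists Q S, [/\ P = Q * S, (1 < size Q)%N & (1 < size S)%N])).
  move=> [Q [S [eP sQ sS]]]; move: P0; rewrite eP mulf_eq0 negb_or => /andP[Q0 S0].
  have sz : size P = (size Q + size S).-1 by rewrite eP size_mul.
  have [||a fa] := IH Q => //; first by lia.
  have [||b fb] := IH S => //; first by lia.
  by exists (a + b)%N; apply: factored_mul.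
move=> irr.
have /fact[m] : lead_coef P != 0 by rewrite lead_coef_eq0.
(* The number of prime factors of the leading coefficient drops with each prime constant divided
   out. *)
elim: m P P0 {sPn} sP irr => [|m IHm] P P0 sP irr fl;
  (case: (classic (exists p, prime_elt p /\ divides p%:P P)) => [[p [pp [Q eP]]]|np];
    last first).
1,3: exists 1%N; rewrite -[P]mulr1; right; last by left; rewrite unitr1.
1,2: apply: primitive_irreducible_prime => //;
       first by move=> p pp dp; apply: np; exists p.
1,2: move=> Q S e; have [|sQ] := leqP (size Q) 1; first by left.
1,2: by right; rewrite leqNgt; apply/negP => sS; apply: irr; exists Q, S.
  have [//|? //] := @factored_div_prime_gt0 A 0 _ p (lead_coef Q) fl pp.
  by rewrite eP lead_coefM lead_coefC.
have [p0 _ _] := pp.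
have sPQ : size P = size Q by rewrite eP mul_polyC size_scale.
have [|||/=|a fa] := IHm Q; rewrite -?sPQ //.
- by apply: contraNneq P0 => Q0; rewrite eP Q0 mulr0.
- move=> [Q1 [S [eQ sQ sS]]]; apply: irr; exists (p%:P * Q1), S; split=> //.
    by rewrite eP eQ mulrA.
  by rewrite mul_polyC size_scale.
- by apply: factored_div_prime fl pp _; rewrite eP lead_coefM lead_coefC.
- by exists a.+1; rewrite eP; right => //; apply: prime_elt_polyC.
Qed.

Lemma factorial_field (k : fieldType) : factorial_ring (k : idomainType).
Proof. by move=> a a0; exists 0%N; left; rewrite unitfE. Qed.

Lemma factorial_R4 (k : fieldType) : factorial_ring (R4 k : idomainType).
Proof. by do 4![apply: factorial_ring_poly]; apply: factorial_field. Qed.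

Definition coprime_elts (A : idomainType) (a b : A) : Prop :=
  forall c, divides c a -> divides c b -> c \is a GRing.unit.

(** A prime factor of [b] cannot divide [a], so it divides [u] and can be cancelled on both sides;
    induction on the factorization of [b]. *)
Lemma coprime_syzygy (A : idomainType) (a b u v : A) :
  factorial_ring A -> b != 0 -> coprime_elts a b -> a * u = b * v -> divides b u.
Proof.
move=> fact b0 co; have [n fb] := fact _ b0; elim: fb {b0} u co => [c uc|{}n p {}b pp fb IH] u co e.
  by exists (c^-1 * u); rewrite mulrA divrr // mul1r.
have [p0 pnu ppr] := pp.
have [[q eq]|[u1 eu]] : divides p a \/ divides p u.
    by apply: ppr; exists (b * v); rewrite e mulrA.
  case/negP: pnu; apply: co; first by exists q.
  by exists b.
have [||q eq] := IH u1.
- move=> c ca [d ed]; apply: co ca _; exists (p * d); rewrite ed; ring.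
- by apply: (mulfI p0); rewrite [RHS]mulrA -e eu; ring.
by exists q; rewrite eu eq mulrA.
Qed.

(** * A trace computation in the plane *)

(** X^L - M^L is a multiple of X - M. Taking determinants, the characteristic polynomial divides a
    power of X, so it is a power of X itself, and the trace is read off its second coefficient. *)
Lemma nilpotent_trace0 (F : fieldType) n (M : 'M[F]_n) L : M ^+ L = 0 -> \tr M = 0.
Proof.
case: n M => [|n] M ML; first by rewrite /mxtrace big_ord0.
have [S eS] : exists S, ('X ^+ L)%:M = char_poly_mx M *m S :> 'M[{poly F}]_n.+1.
  have com : GRing.comm ('X%:M : 'M[{poly F}]_n.+1) (map_mx polyC M).
    by rewrite /GRing.comm -![_ * _]/(_ *m _) scalar_mxC.
  exists (\sum_(i < L) 'X%:M ^+ (L.-1 - i) * map_mx polyC M ^+ i).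
  rewrite -[_ *m _]/(_ * _) /char_poly_mx -subrXX_comm //.
  have -> : map_mx polyC M ^+ L = map_mx polyC (M ^+ L).
    elim: L {ML} => [|L IH]; first by rewrite !expr0 map_mx1.
    by rewrite !exprS IH -![_ * _]/(_ *m _) map_mxM.
  rewrite ML map_mx0 subr0.
  elim: L {ML} => [|L IH]; first by rewrite !expr0.
  by rewrite !exprS -IH -![_ * _%:M]/(_ *m _) -scalar_mxM.
have dvd : char_poly M %| ('X - 0%:P) ^+ (L * n.+1).
  apply/dvdpP; exists (\det S).
  by rewrite subr0 exprM -det_scalar eS det_mulmx mulrC.
have /dvdp_exp_XsubCP[j _] := dvd.
rewrite eqp_monic ?char_poly_monic ?monic_exp ?monicXsubC // => /eqP e.
have := size_char_poly M; rewrite e size_exp_XsubC => -[ej].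
have := char_poly_trace M isT; rewrite e ej subr0 coefXn /= ltn_eqF // => /eqP.
by rewrite eq_sym oppr_eq0 => /eqP.
Qed.

Section Plane.
Variable k : fieldType.
Implicit Types P Q A B r : {poly {poly k}}.

Lemma coef_monoST i j p q :
  (monoST i j : {poly {poly k}})`_p`_q = ((p == i) && (q == j))%:R.
Proof.
rewrite /monoST coefCM coefXn; case: eqP => _ /=; last by rewrite mulr0 coef0.
by rewrite mulr1 coefXn.
Qed.

Lemma monoSTM a b c d :
  monoST a b * monoST c d = monoST (a + c) (b + d) :> {poly {poly k}}.
Proof. by rewrite /monoST !exprD polyCM; ring. Qed.

Lemma coef_monoSTM a b P p q :
  (monoST a b * P)`_p`_q = if (a <= p)%N && (b <= q)%N then P`_(p - a)`_(q - b) else 0.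
Proof.
rewrite /monoST -mulrA coefCM !coefXnM !ltnNge.
by case: (leqP a p); case: (leqP b q); rewrite //= coef0.
Qed.

Lemma coef_cstM (c : k) P p q : (c%:P%:P * P)`_p`_q = c * P`_p`_q.
Proof. by rewrite !coefCM. Qed.

Lemma poly2P P Q : (forall p q, P`_p`_q = Q`_p`_q) -> P = Q.
Proof. by move=> H; apply/polyP => p; apply/polyP => q. Qed.

Lemma poly2_sum P :
  P = \sum_(p < size P) \sum_(q < size P`_p) (P`_p`_q)%:P%:P * monoST p q.
Proof.
rewrite -{1}[P]coefK poly_def; apply: eq_bigr => p _.
rewrite -mul_polyC -{1}[P`_p]coefK poly_def rmorph_sum /= mulr_suml.
by apply: eq_bigr => q _; rewrite /monoST -mul_polyC polyCM mulrA.
Qed.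

Lemma poly2_supp_ind (K : {poly {poly k}} -> Prop) P :
  K 0 -> (forall u v, K u -> K v -> K (u + v)) ->
  (forall p q, P`_p`_q != 0 -> K ((P`_p`_q)%:P%:P * monoST p q)) -> K P.
Proof.
move=> K0 KD KP; rewrite [P]poly2_sum.
apply: (big_ind K) => // p _; apply: (big_ind K) => // q _.
have [->|] := eqVneq P`_p`_q 0; last exact: KP.
by rewrite !polyC0 mul0r.
Qed.

Definition tdeg_lt D P : Prop := forall p q, (D <= p + q)%N -> P`_p`_q = 0.

Lemma tdeg_lt_mono D D' P : (D <= D')%N -> tdeg_lt D P -> tdeg_lt D' P.
Proof. by move=> h H p q h'; apply: H; lia. Qed.

Lemma tdeg_ltD D P Q : tdeg_lt D P -> tdeg_lt D Q -> tdeg_lt D (P + Q).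
Proof. by move=> HP HQ p q h; rewrite !coefD HP // HQ // addr0. Qed.

Lemma tdeg_lt_cstM D c P : tdeg_lt D P -> tdeg_lt D (c%:P%:P * P).
Proof. by move=> HP p q h; rewrite coef_cstM HP // mulr0. Qed.

Lemma tdeg_lt_monoSTM D a b P : tdeg_lt D P -> tdeg_lt (D + a + b) (monoST a b * P).
Proof.
move=> HP p q h; rewrite coef_monoSTM; case: ifP => // /andP[ha hb].
by apply: HP; lia.
Qed.

Lemma tdeg_lt_monoST p q D : (p + q < D)%N -> tdeg_lt D (monoST p q).
Proof. by move=> h p' q' h'; rewrite coef_monoST; do 2!case: eqP => //=; lia. Qed.

(** Degrees add. The hypothesis on [A] bounds its degree by s - s'; as this difference may be
    negative, [s'] stays on the other side. *)
Lemma coef2M0 A B s s' t p q :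
  (forall i j, (s <= i + j + s')%N -> A`_i`_j = 0) -> tdeg_lt t B ->
  (s + t <= p + q + s' + 1)%N -> (A * B)`_p`_q = 0.
Proof.
move=> HA HB h; rewrite coefM coef_sum big1 // => i _.
rewrite coefM big1 // => j _.
have [h1|h1] := leqP s (i + j + s')%N; first by rewrite HA // mul0r.
by rewrite HB ?mulr0 //; have := ltn_ord i; have := ltn_ord j; lia.
Qed.

Variables (n m : nat) (F G F' G' : {poly {poly k}}).
Hypotheses (n0 : (0 < n)%N) (m0 : (0 < m)%N).
Hypotheses (eF : F = monoST n 0 + F') (eG : G = monoST 0 m + G').
Hypotheses (dF : tdeg_lt n.-1 F') (dG : tdeg_lt m.-1 G').

Definition in_FG P := exists A B, P = A * F + B * G.

Lemma in_FG0 : in_FG 0. Proof. by exists 0, 0; rewrite !mul0r addr0. Qed.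

Lemma in_FGD P Q : in_FG P -> in_FG Q -> in_FG (P + Q).
Proof. by move=> [A [B ->]] [A' [B' ->]]; exists (A + A'), (B + B'); ring. Qed.

Lemma in_FGM P Q : in_FG P -> in_FG (Q * P).
Proof. by move=> [A [B ->]]; exists (Q * A), (Q * B); ring. Qed.

(** Normal forms modulo [F] and [G]: [reduce_exists] gives their existence, [box_in_FG0] their
    uniqueness. *)
Definition box r : Prop := forall p q, (n <= p)%N || (m <= q)%N -> r`_p`_q = 0.

Lemma boxD r r' : box r -> box r' -> box (r + r').
Proof. by move=> h h' p q b; rewrite !coefD h // h' // addr0. Qed.

Lemma box_monoST p q : (p < n)%N -> (q < m)%N -> box (monoST p q).
Proof. by move=> hp hq p' q' h; rewrite coef_monoST; do 2!case: eqP => //=; lia. Qed.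

Lemma box_cstM c r : box r -> box (c%:P%:P * r).
Proof. by move=> h p q b; rewrite coef_cstM h // mulr0. Qed.

(* Outside the box one subtracts a multiple of F or G, which lowers the total
   degree by two. *)
Lemma monoST_step c p q : (n <= p)%N || (m <= q)%N ->
  exists Q, tdeg_lt (p + q).-1 Q /\ in_FG (c%:P%:P * monoST p q - Q).
Proof.
case/orP => h.
- exists (- (c%:P%:P * (monoST (p - n) q * F'))); split.
    rewrite -[- (_ * _)]mulNr -!polyCN.
    apply: tdeg_lt_cstM; apply: tdeg_lt_mono (tdeg_lt_monoSTM dF); lia.
  exists (c%:P%:P * monoST (p - n) q), 0; rewrite eF.
  rewrite [in LHS](_ : monoST p q = monoST (p - n) q * monoST n 0); first by ring.
  by rewrite monoSTM; congr monoST; lia.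
- exists (- (c%:P%:P * (monoST p (q - m) * G'))); split.
    rewrite -[- (_ * _)]mulNr -!polyCN.
    apply: tdeg_lt_cstM; apply: tdeg_lt_mono (tdeg_lt_monoSTM dG); lia.
  exists 0, (c%:P%:P * monoST p (q - m)); rewrite eG.
  rewrite [in LHS](_ : monoST p q = monoST p (q - m) * monoST 0 m); first by ring.
  by rewrite monoSTM; congr monoST; lia.
Qed.

Lemma in_FG_trans P Q r : in_FG (P - Q) -> in_FG (Q - r) -> in_FG (P - r).
Proof. by move=> h1 h2; have := in_FGD h1 h2; rewrite addrA subrK. Qed.

Lemma reduce_exists D P : tdeg_lt D P ->
  exists r, [/\ box r, tdeg_lt D r & in_FG (P - r)].
Proof.
elim: D P => [|D IH] P hP.
  exists 0; split; try by move=> *; rewrite !coef0.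
  have -> : P = 0 by apply: poly2P => p q; rewrite hP // !coef0.
  by rewrite subr0; apply: in_FG0.
apply: (@poly2_supp_ind (fun P => exists r, [/\ box r, tdeg_lt D.+1 r & in_FG (P - r)])).
- exists 0; split; try by move=> *; rewrite !coef0.
  by rewrite subr0; apply: in_FG0.
- move=> u v [r [b1 d1 i1]] [r' [b2 d2 i2]]; exists (r + r'); split.
  + exact: boxD.
  + exact: tdeg_ltD.
  + by have := in_FGD i1 i2; rewrite opprD addrACA.
move=> p q cpq; have hpq : (p + q < D.+1)%N.
  by rewrite ltnNge; apply: contra cpq => h; rewrite hP.
have [hb|hb] := boolP ((n <= p)%N || (m <= q)%N); last first.
  exists ((P`_p`_q)%:P%:P * monoST p q); split.
  - by apply: box_cstM; apply: box_monoST; lia.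
  - by apply: tdeg_lt_cstM; apply: tdeg_lt_monoST.
  - by rewrite subrr; apply: in_FG0.
have [Q [dQ iQ]] := monoST_step P`_p`_q hb.
have [|r [br dr ir]] := IH Q; first by apply: tdeg_lt_mono dQ; lia.
exists r; split=> //; first by apply: tdeg_lt_mono dr.
exact: in_FG_trans iQ ir.
Qed.

(** Monomials of [P] in the box stay as they are, and x^i y^j is not among them. The others have
    degree at most i + j and reduce to normal forms of degree below i + j, so x^i y^j never
    appears. *)
Lemma reduce_coef0 i j P : tdeg_lt (i + j).+1 P -> P`_i`_j = 0 ->
  exists r, [/\ box r, r`_i`_j = 0 & in_FG (P - r)].
Proof.
move=> hP hij.
apply: (@poly2_supp_ind (fun P => exists r, [/\ box r, r`_i`_j = 0 & in_FG (P - r)])).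
- exists 0; split; rewrite ?coef0 //; first by move=> *; rewrite !coef0.
  by rewrite subr0; apply: in_FG0.
- move=> u v [r [b1 d1 i1]] [r' [b2 d2 i2]]; exists (r + r'); split.
  + exact: boxD.
  + by rewrite !coefD d1 d2 addr0.
  + by have := in_FGD i1 i2; rewrite opprD addrACA.
move=> p q cpq; have hpq : (p + q < (i + j).+1)%N.
  by rewrite ltnNge; apply: contra cpq => h; rewrite hP.
have [hb|hb] := boolP ((n <= p)%N || (m <= q)%N); last first.
  exists ((P`_p`_q)%:P%:P * monoST p q); split.
  - by apply: box_cstM; apply: box_monoST; lia.
  - rewrite coef_cstM coef_monoST; case: andP => [[/eqP e1 /eqP e2]|_]; last by rewrite mulr0.
    by rewrite -e1 -e2 hij mul0r.
  - by rewrite subrr; apply: in_FG0.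
have [Q [dQ iQ]] := monoST_step P`_p`_q hb.
have [|r [br dr ir]] := @reduce_exists (i + j) Q; first by apply: tdeg_lt_mono dQ; lia.
exists r; split=> //; first by apply: dr.
exact: in_FG_trans iQ ir.
Qed.

(** This is the zero diagonal of multiplication by xy. If the product leaves the box, say with i + 1
    = n, it is congruent to -y^(j+1) F'. That has degree at most i + j, as F' has degree at most n -
    2, and no term x^i y^j, being divisible by y^(j+1). *)
Lemma xy_normal_form i j : (i < n)%N -> (j < m)%N ->
  exists r, [/\ box r, r`_i`_j = 0 & in_FG (monoST i.+1 j.+1 - r)].
Proof.
move=> hi hj.
have [hb|hb] := boolP ((n <= i.+1)%N || (m <= j.+1)%N); last first.
  exists (monoST i.+1 j.+1); split.
  - by apply: box_monoST; lia.
  - by rewrite coef_monoST; case: eqP => //=; lia.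
  - by rewrite subrr; apply: in_FG0.
case/orP: hb => h.
- have [||r [br cr ir]] := @reduce_coef0 i j (- (monoST 0 j.+1 * F')).
  + move=> p q hpq; rewrite !coefN (tdeg_lt_monoSTM dF) ?oppr0 //; lia.
  + by rewrite !coefN coef_monoSTM ltnn andbF oppr0.
  + exists r; split=> //; apply: in_FG_trans ir.
    exists (monoST 0 j.+1), 0; rewrite eF mulrDr monoSTM.
    have -> : i.+1 = n by lia.
    by rewrite add0n addn0 mul0r addr0 opprK.
- have [||r [br cr ir]] := @reduce_coef0 i j (- (monoST i.+1 0 * G')).
  + move=> p q hpq; rewrite !coefN (tdeg_lt_monoSTM dG) ?oppr0 //; lia.
  + by rewrite !coefN coef_monoSTM ltnn oppr0.
  + exists r; split=> //; apply: in_FG_trans ir.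
    exists 0, (monoST i.+1 0); rewrite eG mulrDr monoSTM.
    have -> : j.+1 = m by lia.
    by rewrite add0n addn0 mul0r add0r opprK.
Qed.

(* The leading forms x^n and y^m have only the Koszul syzygy, so a top-degree
   cancellation in A F + B G can be removed by (A, B) := (A - Q G, B + Q F). *)
Lemma box_in_FG0 r : box r -> in_FG r -> r = 0.
Proof.
move=> br [A [B er]].
(* [D] exceeds deg A + n and deg B + m; the induction lowers it to 0, where [A] and [B] vanish. *)
have [D [hA hB]] : exists D, (forall p q, (D <= p + q + n)%N -> A`_p`_q = 0) /\
    (forall p q, (D <= p + q + m)%N -> B`_p`_q = 0).
  have bnd P : exists D, tdeg_lt D P.
    apply: (@poly2_supp_ind (fun P => exists D, tdeg_lt D P)).
    - by exists 0%N => p q _; rewrite !coef0.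
    - move=> u v [D1 h1] [D2 h2]; exists (maxn D1 D2); apply: tdeg_ltD.
        by apply: tdeg_lt_mono h1; lia.
      by apply: tdeg_lt_mono h2; lia.
    - move=> p q _; exists (p + q).+1; apply: tdeg_lt_cstM.
      exact: tdeg_lt_monoST.
  have [D1 h1] := bnd A; have [D2 h2] := bnd B.
  by exists (D1 + D2 + n + m)%N; split=> p q h; [apply: h1|apply: h2]; lia.
elim: D A B er hA hB => [|D IH] A B er hA hB.
  have -> : r = 0 * F + 0 * G.
    rewrite er; congr (_ * _ + _ * _); apply: poly2P => p q; rewrite !coef0.
      exact: hA.
    exact: hB.
  by rewrite !mul0r addr0.
have cF P p q : (P * monoST n 0)`_p`_q = if (n <= p)%N then P`_(p - n)`_q else 0.
  by rewrite mulrC coef_monoSTM subn0 andbT.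
have cG P p q : (P * monoST 0 m)`_p`_q = if (m <= q)%N then P`_p`_(q - m) else 0.
  by rewrite mulrC coef_monoSTM subn0.
have top p q : (p + q)%N = D ->
    r`_p`_q = (if (n <= p)%N then A`_(p - n)`_q else 0)
            + (if (m <= q)%N then B`_p`_(q - m) else 0).
  move=> e; rewrite er eF eG !mulrDr !coefD cF cG.
  rewrite (coef2M0 hA dF) ?(coef2M0 hB dG) ?addr0 //; lia.
(* In degree [D] the box condition makes the part of [A] of degree D - n divisible by y^m. [Q] is
   the quotient, and the part of [B] of degree D - m is then -Q x^n. *)
pose Q : {poly {poly k}} := \poly_(p < D.+1) \poly_(q < D.+1)
   (if (p + q + m + n == D)%N then A`_p`_(q + m) else 0).
have cQ p q : Q`_p`_q = if (p + q + m + n == D)%N then A`_p`_(q + m) else 0.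
  rewrite /Q coef_poly; case: ltnP => hp; last by rewrite coef0; case: eqP => //; lia.
  by rewrite coef_poly; case: ltnP => hq //; case: eqP => //; lia.
have hQ p q : (D.+1 <= p + q + (m + n))%N -> Q`_p`_q = 0.
  by move=> h; rewrite cQ; case: eqP => //; lia.
have eQ p q : (p + q + m + n)%N = D -> Q`_p`_q = - B`_(p + n)`_q.
  move=> e; rewrite cQ e eqxx.
  have := top (p + n)%N (q + m)%N; rewrite br; last by lia.
  rewrite !leq_addl !addnK => H; apply/eqP; rewrite -addr_eq0 -H //; lia.
apply: (IH (A - Q * G) (B + Q * F)); first by rewrite er; ring.
- move=> p q h; rewrite eG mulrDr !coefB !coefD cG.
  rewrite (coef2M0 hQ dG) ?addr0; last by lia.
  have [e|ne] := eqVneq (p + q + n)%N D; last first.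
    rewrite hA; last by lia.
    by case: ifP => [hm|_]; rewrite ?subr0 // hQ ?subr0 //; lia.
  case: leqP => hm.
    by rewrite cQ ifT ?subnK ?subrr //; lia.
  have := top (p + n)%N q; rewrite br ?leq_addl // addnK ifF; last by lia.
  rewrite addr0 subr0 => <- //; lia.
- move=> p q h; rewrite eF mulrDr !coefD cF.
  rewrite (coef2M0 hQ dF) ?addr0; last by lia.
  have [e|ne] := eqVneq (p + q + m)%N D; last first.
    rewrite hB; last by lia.
    by case: ifP => [hm|_]; rewrite ?addr0 // hQ ?addr0 //; lia.
  case: leqP => hn.
    by rewrite eQ ?subnK ?addrN //; lia.
  have := top p (q + m)%N; rewrite br ?leq_addl ?orbT // addnK ifF; last by lia.
  rewrite add0r addr0 => <- //; lia.
Qed.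

Lemma xy_nilpotent_char L : in_FG ((monoST 1 1 - 1) ^+ L) -> (n * m)%:R = 0 :> k.
Proof.
move=> hL.
pose I : finType := ('I_n * 'I_m)%type.
have hex (s : I) : exists r,
    [/\ box r, r`_s.1`_s.2 = 0 & in_FG (monoST s.1.+1 s.2.+1 - r)].
  by apply: xy_normal_form.
have [r hr] := fin_all_exists hex.
pose ev (s : 'I_#|I|) : I := enum_val s.
have evK (x : I) : ev (enum_rank x) = x by apply: enum_rankK.
(* Row [s] is the normal form of xy times the basis monomial [s]. *)
pose X : 'M[k]_#|I| := \matrix_(s, t) (r (ev s))`_(ev t).1`_(ev t).2.
pose Phi (v : 'rV[k]_#|I|) : {poly {poly k}} :=
  \sum_s (v 0 s)%:P%:P * monoST (ev s).1 (ev s).2.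
have PhiD u v : Phi (u + v) = Phi u + Phi v.
  rewrite /Phi -big_split; apply: eq_bigr => s _ /=.
  by rewrite mxE !polyCD mulrDl.
have PhiN u : Phi (- u) = - Phi u.
  rewrite /Phi -sumrN; apply: eq_bigr => s _ /=.
  by rewrite mxE !polyCN mulNr.
have Phi_box v : box (Phi v).
  rewrite /Phi; apply: (big_ind box) => [p q _|*|s _]; first by rewrite !coef0.
    exact: boxD.
  by apply: box_cstM; apply: box_monoST.
have cPhi v s : (Phi v)`_(ev s).1`_(ev s).2 = v 0 s.
  rewrite /Phi !coef_sum (bigD1 s) //= coef_cstM coef_monoST !eqxx mulr1.
  rewrite big1 ?addr0 // => t ts; rewrite coef_cstM coef_monoST.
  case: andP => [[/eqP e1 /eqP e2]|_]; last by rewrite mulr0.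
  case/eqP: ts; apply: enum_val_inj; rewrite -/(ev s) -/(ev t); move: e1 e2.
  case: (ev s) (ev t) => [i j] [i' j'] /= e1 e2.
  by congr pair; apply: val_inj; rewrite /= ?e1 ?e2.
have Phi0 v : in_FG (Phi v) -> v = 0.
  move=> h; apply/rowP => s; rewrite -cPhi (box_in_FG0 (Phi_box v) h).
  by rewrite !coef0 mxE.
have Phi_r s : Phi (row s X) = r (ev s).
  apply: poly2P => p q; have [br _ _] := hr (ev s).
  have [hpq|hpq] := boolP ((n <= p)%N || (m <= q)%N).
    by rewrite br // Phi_box.
  have hp : (p < n)%N by lia.
  have hq : (q < m)%N by lia.
  have := cPhi (row s X) (enum_rank ((Ordinal hp, Ordinal hq) : I)).
  by rewrite evK /= => ->; rewrite !mxE evK.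
have PhiX v : Phi (v *m X) = \sum_s (v 0 s)%:P%:P * r (ev s).
  rewrite mulmx_sum_row; elim/big_rec2: _ => [|s y1 y2 _ ey].
    by rewrite /Phi big1 // => s _; rewrite mxE !polyC0 mul0r.
  rewrite PhiD ey -Phi_r; congr (_ + _).
  rewrite /Phi mulr_sumr; apply: eq_bigr => t _.
  by rewrite !mxE !polyCM mulrA.
have stepX v : in_FG (monoST 1 1 * Phi v - Phi (v *m X)).
  rewrite PhiX /Phi mulr_sumr -sumrB; apply: (big_ind in_FG) => [||s _].
  - exact: in_FG0.
  - exact: in_FGD.
  rewrite mulrCA monoSTM !add1n -mulrBr; apply: in_FGM.
  by have [] := hr (ev s).
(* [M] represents multiplication by xy - 1, so [M ^+ L] sends each basis vector to a normal form
   lying in (F, G), that is, to 0. *)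
pose M := X - 1%:M.
have stepM v : in_FG ((monoST 1 1 - 1) * Phi v - Phi (v *m M)).
  rewrite /M mulmxBr mulmx1 PhiD PhiN; have := stepX v; congr in_FG.
  ring.
have iterM l v : in_FG ((monoST 1 1 - 1) ^+ l * Phi v - Phi (v *m M ^+ l)).
  elim: l v => [|l IH] v; first by rewrite !expr0 mul1r mulmx1 subrr; apply: in_FG0.
  have h1 := in_FGM ((monoST 1 1 - 1) ^+ l) (stepM v).
  have := in_FGD h1 (IH (v *m M)); congr in_FG.
  rewrite (_ : v *m M ^+ l.+1 = v *m M *m M ^+ l); last by rewrite exprS -mulmxA.
  rewrite [_ ^+ l.+1]exprSr; ring.
have ML : M ^+ L = 0.
  apply/row_matrixP => s; rewrite row0; apply: Phi0.
  rewrite rowE.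
  have h1 := iterM L (delta_mx 0 s).
  have h2 := in_FGM (Phi (delta_mx 0 s)) hL.
  have := in_FGD h2 (in_FGM (-1) h1); congr in_FG; ring.
have := nilpotent_trace0 ML; rewrite /M mxtraceD raddfN /= mxtrace1.
have -> : \tr X = 0.
  rewrite /mxtrace big1 // => s _; rewrite mxE.
  by have [] := hr (ev s).
by rewrite add0r => /eqP; rewrite oppr_eq0 card_prod !card_ord => /eqP.
Qed.

End Plane.

(** * Gradings *)

(* An interface to k[w,x,y,z] by its monomials and evaluation morphisms, so that proofs do
   not see the nesting of R4; cf P a b c d is the coefficient of w^a x^b y^c z^d. *)
Record poly4 (k : fieldType) := Poly4 {
  car :> idomainType;
  cst : {rmorphism k -> car};
  mono : nat -> nat -> nat -> nat -> car;
  cf : car -> nat -> nat -> nat -> nat -> k;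
  ev : forall B : comNzRingType, {rmorphism k -> B} -> B -> B -> B -> B ->
    {rmorphism car -> B};
  mono0 : mono 0 0 0 0 = 1;
  monoM : forall a b c d a' b' c' d', mono a b c d * mono a' b' c' d' =
    mono (a + a')%N (b + b')%N (c + c')%N (d + d')%N;
  cfD : forall P Q a b c d, cf (P + Q) a b c d = cf P a b c d + cf Q a b c d;
  cf_cstM : forall t P a b c d, cf (cst t * P) a b c d = t * cf P a b c d;
  cf_mono : forall a b c d a' b' c' d', cf (mono a b c d) a' b' c' d' =
    ((a' == a) && (b' == b) && (c' == c) && (d' == d))%:R;
  poly4_supp_ind : forall (K : car -> Prop) P,
    K 0 -> (forall u v, K u -> K v -> K (u + v)) ->
    (forall a b c d, cf P a b c d != 0 -> K (cst (cf P a b c d) * mono a b c d)) ->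
    K P;
  ev_mono : forall (B : comNzRingType) (i : {rmorphism k -> B}) (bw bx by_ bz : B) t a b c d,
    ev i bw bx by_ bz (cst t * mono a b c d)
      = i t * (bw ^+ a * bx ^+ b * by_ ^+ c * bz ^+ d);
  poly4_factorial : factorial_ring car
}.

Arguments mono {k S} : rename.
Arguments cst {k S} : rename.
Arguments cf {k S} : rename.
Arguments ev {k} S {B} : rename.

Section Grading.
Variables (k : fieldType) (S : poly4 k).
Implicit Types P Q : S.

Lemma monoX a b c d n :
  (mono a b c d : S) ^+ n = mono (a * n) (b * n) (c * n) (d * n).
Proof.
elim: n => [|n IH]; first by rewrite !muln0 mono0.
by rewrite exprS IH monoM !mulnS.
Qed.

Lemma poly4_ind (K : S -> Prop) :
  K 0 -> (forall u v, K u -> K v -> K (u + v)) ->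
  (forall t a b c d, K (cst t * mono a b c d)) -> forall P, K P.
Proof. by move=> K0 KD Km P; apply: poly4_supp_ind. Qed.

Lemma cf0 a b c d : cf (0 : S) a b c d = 0.
Proof. by rewrite -[0](mul0r 0) -(rmorph0 cst) cf_cstM mul0r. Qed.

Lemma cfN P a b c d : cf (- P) a b c d = - cf P a b c d.
Proof. by apply/eqP; rewrite -addr_eq0 -cfD addNr cf0. Qed.

Lemma cfP P Q : (forall a b c d, cf P a b c d = cf Q a b c d) -> P = Q.
Proof.
move=> H; apply/eqP; rewrite -subr_eq0; apply/eqP.
apply: (@poly4_supp_ind k S (fun R => R = 0)) => // [u v -> ->|a b c d].
  by rewrite addr0.
by rewrite cfD cfN H subrr eqxx.
Qed.

Lemma monoSTX i j n : (monoST i j : {poly {poly k}}) ^+ n = monoST (i * n) (j * n).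
Proof.
elim: n => [|n IH]; first by rewrite !muln0 /monoST !expr0 mulr1.
by rewrite exprS IH monoSTM !mulnS.
Qed.

Definition par : {rmorphism S -> {poly {poly k}}} :=
  ev S (polyC \o polyC) (monoST 4 0) (monoST 3 1) (monoST 1 3) (monoST 0 4).

Lemma par_mono t a b c d : par (cst t * mono a b c d) =
  t%:P%:P * monoST (bideg1 a b c d) (bideg2 a b c d).
Proof.
rewrite ev_mono /=; congr (_ * _).
rewrite !monoSTX !monoSTM /bideg1 /bideg2; congr monoST; lia.
Qed.

Definition weight := (nat * nat * nat * nat)%type.
Implicit Types o : weight.

Definition wdeg o (a b c d : nat) : nat :=
  (o.1.1.1 * a + o.1.1.2 * b + o.1.2 * c + o.2 * d)%N.

(* The coefficient of T^i in Gam o P is the o-homogeneous component of degree i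
   of P, so the multiplicativity of Gam encodes the grading. *)
Definition Gam o : {rmorphism S -> {poly S}} :=
  ev S (polyC \o cst) ((mono 1 0 0 0)%:P * 'X^(o.1.1.1)) ((mono 0 1 0 0)%:P * 'X^(o.1.1.2))
    ((mono 0 0 1 0)%:P * 'X^(o.1.2)) ((mono 0 0 0 1)%:P * 'X^(o.2)).

Lemma mono_split a b c d : mono a b c d =
  
  mono 1 0 0 0 ^+ a * mono 0 1 0 0 ^+ b * mono 0 0 1 0 ^+ c * mono 0 0 0 1 ^+ d :> S.
Proof. by rewrite !monoX !monoM !mul0n !mul1n !add0n !addn0. Qed.

Lemma Gam_mono o t a b c d :
  Gam o (cst t * mono a b c d) = (cst t * mono a b c d)%:P * 'X^(wdeg o a b c d).
Proof.
have aux (A : comNzRingType) (x y1 y2 y3 y4 : A) (o1 o2 o3 o4 : nat) :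
    x%:P * ((y1%:P * 'X^o1) ^+ a * (y2%:P * 'X^o2) ^+ b *
            (y3%:P * 'X^o3) ^+ c * (y4%:P * 'X^o4) ^+ d) =
    (x * (y1 ^+ a * y2 ^+ b * y3 ^+ c * y4 ^+ d))%:P *
      'X^(o1 * a + o2 * b + o3 * c + o4 * d) :> {poly A}.
  rewrite !exprMn -!exprM !exprD !polyCM !polyC_exp; ring.
by rewrite /Gam ev_mono /= [in RHS]mono_split; apply: aux.
Qed.

Lemma coef_Gam o P i a b c d :
  cf (Gam o P)`_i a b c d = if wdeg o a b c d == i then cf P a b c d else 0.
Proof.
elim/poly4_ind: P => [|u v Hu Hv|t a' b' c' d'].
- by rewrite rmorph0 coef0 cf0 if_same.
- by rewrite rmorphD coefD !cfD Hu Hv; case: ifP => // _; rewrite addr0.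
rewrite Gam_mono coefCM coefXn mulr_natr.
case: (eqVneq i (wdeg o a' b' c' d')) => [->|ne].
  rewrite cf_cstM cf_mono.
  case: andP => [[/andP[/andP[/eqP-> /eqP->] /eqP->] /eqP->]|_]; first by rewrite eqxx.
  by rewrite mulr0 if_same.
rewrite mulr0n cf0 cf_cstM cf_mono.
case: andP => [[/andP[/andP[/eqP-> /eqP->] /eqP->] /eqP->]|_].
  by rewrite eq_sym (negbTE ne).
by rewrite mulr0 if_same.
Qed.

Definition whomog o (i : nat) P : Prop :=
  forall a b c d, cf P a b c d != 0 -> wdeg o a b c d = i.

Lemma whomogP o i P : whomog o i P <-> Gam o P = P%:P * 'X^i.
Proof.
split=> [h|h a b c d cP].
  apply/polyP => j; apply: cfP => a b c d; rewrite coef_Gam coefCM coefXn.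
  case: (eqVneq j i) => [->|ne]; rewrite ?mulr1 ?mulr0 ?cf0.
    case: eqP => // hd; apply/esym/eqP; apply: contra_notT hd; exact: h.
  case: eqP => // hd; apply/eqP; apply: contraNT ne => /h <-.
  by rewrite hd.
move: cP; have := coef_Gam o P (wdeg o a b c d) a b c d.
rewrite eqxx h coefCM coefXn mulr_natr => <-.
by case: (wdeg o a b c d =P i) => // _; rewrite mulr0n cf0 eqxx.
Qed.

Lemma Gam1 o P : (Gam o P).[1] = P.
Proof.
elim/poly4_ind: P => [|u v Hu Hv|t a b c d]; first by rewrite rmorph0 horner0.
  by rewrite rmorphD hornerD Hu Hv.
by rewrite Gam_mono hornerCM hornerXn expr1n mulr1.
Qed.

Lemma Gam_eq0 o P : (Gam o P == 0) = (P == 0).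
Proof.
apply/eqP/eqP => [h|->]; last by rewrite rmorph0.
by rewrite -(Gam1 o P) h horner0.
Qed.

Lemma whomog0 o i : whomog o i 0.
Proof. by move=> a b c d; rewrite cf0 eqxx. Qed.

Lemma whomogD o i P Q : whomog o i P -> whomog o i Q -> whomog o i (P + Q).
Proof. by rewrite !whomogP rmorphD => -> ->; rewrite polyCD mulrDl. Qed.

Lemma whomogN o i P : whomog o i P -> whomog o i (- P).
Proof. by rewrite !whomogP rmorphN => ->; rewrite polyCN mulNr. Qed.

Lemma whomogM o i j P Q : whomog o i P -> whomog o j Q -> whomog o (i + j) (P * Q).
Proof. by rewrite !whomogP rmorphM => -> ->; rewrite polyCM exprD; ring. Qed.

Lemma whomog_cst o t : whomog o 0 (cst t).
Proof.
rewrite whomogP; have := Gam_mono o t 0 0 0 0; rewrite mono0 mulr1 => ->.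
by rewrite /wdeg !muln0.
Qed.

Lemma whomogX o i P n : whomog o i P -> whomog o (i * n) (P ^+ n).
Proof.
by rewrite !whomogP rmorphXn /= => ->; rewrite exprMn -rmorphXn -exprM.
Qed.

Lemma whomog_mono o a b c d : whomog o (wdeg o a b c d) (mono a b c d).
Proof. by rewrite whomogP; have := Gam_mono o 1 a b c d; rewrite rmorph1 mul1r. Qed.

(** Splitting off the powers of X from [U] and [V] leaves cofactors with nonzero constant terms.
    Their product also has a nonzero constant term, so it is the constant [c], and in a domain both
    cofactors are constant. *)
Lemma monomial_factor (A : idomainType) (U V : {poly A}) (c : A) i :
  c != 0 -> U * V = c%:P * 'X^i -> exists a j, U = a%:P * 'X^j.
Proof.
move=> c0 e.
have [U0 V0] : U != 0 /\ V != 0.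
  apply/andP; rewrite -negb_or -mulf_eq0 e mulf_eq0 polyC_eq0 negb_or c0.
  by rewrite -size_poly_eq0 size_polyXn.
have [j [U1 /implyP/(_ U0) rU eU]] := multiplicity_XsubC U 0.
have [l [V1 /implyP/(_ V0) rV eV]] := multiplicity_XsubC V 0.
rewrite subr0 in eU eV.
have e1 : U1 * V1 * 'X^(j + l) = c%:P * 'X^i by rewrite -e eU eV exprD; ring.
have ei : i = (j + l)%N.
  have := congr1 (fun p : {poly A} => p`_(j + l)) e1.
  rewrite /= coefMXn ltnn subnn coefCM coefXn coefM big_ord1 /= => e2.
  apply/eqP; rewrite eq_sym; apply: contraT => ne; move: e2.
  rewrite (negbTE ne) mulr0 => /eqP; rewrite mulf_eq0 -!horner_coef0.
  by rewrite -!rootE (negbTE rU) (negbTE rV).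
have eUV : U1 * V1 = c%:P.
  by apply: (mulIf (x := 'X^i)); rewrite ?monic_neq0 ?monicXn // {1}ei.
exists U1`_0, j; rewrite {1}eU; congr (_ * _); apply: size1_polyC.
have U10 : U1 != 0 by apply: contraNneq U0 => U10; rewrite eU U10 mul0r.
have V10 : V1 != 0 by apply: contraNneq V0 => V10; rewrite eV V10 mul0r.
have := size_mul U10 V10; rewrite eUV size_polyC c0.
move: V10; rewrite -size_poly_gt0 /=; move: (size U1) (size V1); lia.
Qed.

(** [Gam] is multiplicative and takes homogeneous elements to monomials in T, so this is a statement
    about factors of a monomial. *)
Lemma whomog_factor o i P Q : whomog o i (P * Q) -> P * Q != 0 ->
  exists j, whomog o j P.
Proof.
rewrite whomogP rmorphM => e PQ0; have [a [j ea]] := monomial_factor PQ0 e.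
exists j; rewrite whomogP ea; congr (_%:P * _).
by rewrite -(Gam1 o P) ea hornerCM hornerXn expr1n mulr1.
Qed.

Lemma whomog_uniq o i j P : whomog o i P -> whomog o j P -> P != 0 -> i = j.
Proof.
rewrite !whomogP => -> /eqP; rewrite -subr_eq0 -mulrBr mulf_eq0 polyC_eq0 => e P0.
move: e; rewrite (negbTE P0) subr_eq0 => /eqP /(congr1 (fun p : {poly S} => size p)).
by rewrite !size_polyXn => -[].
Qed.

Definition hcomp o i P : S := (Gam o P)`_i.

Lemma coef_comp o i P a b c d :
  cf (hcomp o i P) a b c d = if wdeg o a b c d == i then cf P a b c d else 0.
Proof. exact: coef_Gam. Qed.

Lemma whomog_hcomp o i P : whomog o i (hcomp o i P).
Proof. by move=> a b c d; rewrite coef_comp; case: ifP => [/eqP //|_]; rewrite eqxx. Qed.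

Lemma whomog_hcomp_pres o o' i j P : whomog o' j P -> whomog o' j (hcomp o i P).
Proof. by move=> h a b c d; rewrite coef_comp; case: ifP => _; [apply: h|rewrite eqxx]. Qed.

Lemma hcompD o i P Q : hcomp o i (P + Q) = hcomp o i P + hcomp o i Q.
Proof. by rewrite /hcomp rmorphD coefD. Qed.

Lemma hcompM o i j P Q : whomog o j Q -> hcomp o (i + j) (P * Q) = hcomp o i P * Q.
Proof.
move/whomogP => e; rewrite /hcomp rmorphM e.
by rewrite mulrA coefMXn ifF ?addnK ?coefMC //; lia.
Qed.

Lemma hcomp_id o i P : whomog o i P -> hcomp o i P = P.
Proof. by move/whomogP; rewrite /hcomp => ->; rewrite coefCM coefXn eqxx mulr1. Qed.

(** The leading form for the weight [o]. Both extremal components are of this kind: on forms of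
    degree n the two bidegrees sum to 4n, so the top component for [ow2] is the lowest one for
    [ow1]. *)
Definition lc o P : S := lead_coef (Gam o P).

Lemma lcE o P : lc o P = hcomp o (size (Gam o P)).-1 P.
Proof. by []. Qed.

Lemma lcM o P Q : lc o (P * Q) = lc o P * lc o Q.
Proof. by rewrite /lc rmorphM lead_coefM. Qed.

Lemma lc_eq0 o P : (lc o P == 0) = (P == 0).
Proof. by rewrite /lc lead_coef_eq0 Gam_eq0. Qed.

Lemma lc_id o i P : whomog o i P -> lc o P = P.
Proof.
move/whomogP; rewrite /lc => ->.
by rewrite lead_coefM lead_coefXn lead_coefC mulr1.
Qed.

Definition ow1 : weight := (4, 3, 1, 0)%N.
Definition ow2 : weight := (0, 1, 3, 4)%N.
Definition otot : weight := (1, 1, 1, 1)%N.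

Lemma wdeg_tot a b c d : wdeg otot a b c d = (a + b + c + d)%N.
Proof. rewrite /wdeg /=; lia. Qed.
Lemma wdeg_ow1 a b c d : wdeg ow1 a b c d = bideg1 a b c d.
Proof. rewrite /wdeg /bideg1 /=; lia. Qed.
Lemma wdeg_ow2 a b c d : wdeg ow2 a b c d = bideg2 a b c d.
Proof. rewrite /wdeg /bideg2 /=; lia. Qed.

Lemma bideg_sum a b c d :
  (bideg1 a b c d + bideg2 a b c d = 4 * (a + b + c + d))%N.
Proof. rewrite /bideg1 /bideg2; lia. Qed.

Lemma cf_neq0 P : P != 0 -> exists a b c d, cf P a b c d != 0.
Proof.
move=> P0; apply: NNPP => h; case/eqP: P0; apply: cfP => a b c d.
rewrite cf0; apply/eqP; apply: contra_notT h => h; by exists a, b, c, d.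
Qed.

(** * Extremal bihomogeneous components as leading forms *)

Section Extremal.
Variable bic : nat -> nat -> S -> S.
Hypothesis cf_bic : forall i j P a b c d, cf (bic i j P) a b c d =
  if (bideg1 a b c d == i) && (bideg2 a b c d == j) then cf P a b c d else 0.

Lemma bic_comp1 n P i : whomog otot n P -> bic i (4 * n - i) P = hcomp ow1 i P.
Proof.
move=> hP; apply: cfP => a b c d; rewrite cf_bic coef_comp wdeg_ow1.
have [->|/hP] := eqVneq (cf P a b c d) 0; first by rewrite !if_same.
rewrite wdeg_tot => hn.
have := bideg_sum a b c d; rewrite hn.
case: eqP => //= -> h; case: eqP => //; lia.
Qed.

Lemma bic_comp2 n P i : whomog otot n P -> (i <= 4 * n)%N ->
  bic i (4 * n - i) P = hcomp ow2 (4 * n - i) P.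
Proof.
move=> hP hi; apply: cfP => a b c d; rewrite cf_bic coef_comp wdeg_ow2.
have [->|/hP] := eqVneq (cf P a b c d) 0; first by rewrite !if_same.
rewrite wdeg_tot => hn.
have := bideg_sum a b c d; rewrite hn.
case: (eqVneq (bideg2 a b c d)) => //= [-> h|]; last by rewrite andbF.
case: eqP => //; lia.
Qed.

Lemma imax_lc n P i : whomog otot n P -> bic i (4 * n - i) P != 0 /\
    (forall i', bic i' (4 * n - i') P != 0 -> (i' <= i)%N) -> bic i (4 * n - i) P = lc ow1 P.
Proof.
move=> hP [h1 h2]; rewrite bic_comp1 // in h1 *; rewrite lcE; congr hcomp.
have P0 : P != 0.
  by apply: contraNneq h1 => ->; rewrite /hcomp rmorph0 coef0.
apply/eqP; rewrite eqn_leq h2 ?andbT.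
  rewrite -ltnS prednK ?size_poly_gt0 ?Gam_eq0 // ltnNge.
  by apply: contra h1 => h; rewrite /hcomp nth_default.
by rewrite bic_comp1 // -lcE lc_eq0.
Qed.

Lemma imin_lc n P i : whomog otot n P -> bic i (4 * n - i) P != 0 /\
    (forall i', bic i' (4 * n - i') P != 0 -> (i <= i')%N) -> bic i (4 * n - i) P = lc ow2 P.
Proof.
move=> hP [h1 h2].
(* Subtraction is truncated, so 4n - i determines i only within this range; a nonzero component
   guarantees it. *)
have hi : (i <= 4 * n)%N.
  have [a [b [c [d]]]] := cf_neq0 h1; rewrite cf_bic.
  case: ifP => [/andP[/eqP <- _]|_]; last by rewrite eqxx.
  by move/hP => <-; rewrite wdeg_tot -bideg_sum leq_addr.
rewrite bic_comp2 // in h1 *; rewrite lcE; congr hcomp.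
have P0 : P != 0.
  by apply: contraNneq h1 => ->; rewrite /hcomp rmorph0 coef0.
set s := (size _).-1.
have s1 : (4 * n - i <= s)%N.
  rewrite -ltnS prednK ?size_poly_gt0 ?Gam_eq0 // ltnNge.
  by apply: contra h1 => h; rewrite /hcomp nth_default.
have cs : hcomp ow2 s P != 0 by rewrite -lcE lc_eq0.
have s2 : (s <= 4 * n)%N.
  have [a [b [c [d]]]] := cf_neq0 cs; rewrite coef_comp.
  case: ifP => [/eqP <-|_]; last by rewrite eqxx.
  by move/hP => <-; rewrite wdeg_tot -bideg_sum wdeg_ow2 leq_addl.
have := h2 (4 * n - s)%N; rewrite bic_comp2 //; last by lia.
rewrite subKn // => /(_ cs); lia.
Qed.

End Extremal.

Lemma bihomog o i n P : o = ow1 \/ o = ow2 -> whomog otot n P -> whomog o i P ->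
  exists e1 e2, whomog ow1 e1 P /\ whomog ow2 e2 P.
Proof.
move=> [] -> hn hi.
  exists i, (4 * n - i)%N; split=> // a b c d cP.
  by move: (hi _ _ _ _ cP) (bideg_sum a b c d);
    rewrite wdeg_ow1 wdeg_ow2 -(hn _ _ _ _ cP) wdeg_tot; lia.
exists (4 * n - i)%N, i; split=> // a b c d cP.
by move: (hi _ _ _ _ cP) (bideg_sum a b c d);
  rewrite wdeg_ow1 wdeg_ow2 -(hn _ _ _ _ cP) wdeg_tot; lia.
Qed.

(** All monomials of a given bidegree have the same image under the parametrization. *)
Lemma par_bihomog e1 e2 P : whomog ow1 e1 P -> whomog ow2 e2 P ->
  exists t : k, par P = t%:P%:P * monoST e1 e2.
Proof.
move=> h1 h2.
apply: (@poly4_supp_ind k S (fun Q => exists t : k, par Q = t%:P%:P * monoST e1 e2)).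
- by exists 0; rewrite rmorph0 !polyC0 mul0r.
- move=> u v [x ex] [y ey]; exists (x + y).
  by rewrite rmorphD ex ey !polyCD mulrDl.
- move=> a b c d cP; exists (cf P a b c d); rewrite par_mono.
  by rewrite -wdeg_ow1 -wdeg_ow2 (h1 _ _ _ _ cP) (h2 _ _ _ _ cP).
Qed.

End Grading.

(** * Dimension count *)

Section Count.
Variables (k : fieldType) (S : poly4 k).
Implicit Types P Q : S.
Local Notation hom := (@whomog k S otot).

(** Exponent vectors of degree [D], in the shape counted by [card_ord_partitions]. *)
Definition expo (D : nat) : finType :=
  {t : 4.-tuple 'I_D.+1 | t \in [set t : 4.-tuple 'I_D.+1 | (\sum_(i <- t) i == D)%N]}.

Definition nmono D := #|expo D|.

Definition xpo D (s : 'I_(nmono D)) (i : 'I_4) : nat := tnth (val (enum_val s)) i.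
Definition o0 : 'I_4 := @Ordinal 4 0 isT.
Definition o1 : 'I_4 := @Ordinal 4 1 isT.
Definition o2 : 'I_4 := @Ordinal 4 2 isT.
Definition o3 : 'I_4 := @Ordinal 4 3 isT.

Lemma nmonoE D : nmono D = 'C(3 + D, 3).
Proof.
by rewrite -card_ord_partitions /nmono /expo card_sig; apply: eq_card => t; rewrite !inE.
Qed.

Lemma nmono6 D : (nmono D * 6 = (D + 1) * (D + 2) * (D + 3))%N.
Proof.
rewrite nmonoE -[6%N]/(3`!) bin_ffact !ffactnS ffactn0.
by rewrite !add3n /= muln1; lia.
Qed.

Lemma ex_sum D (s : 'I_(nmono D)) : (xpo s o0 + xpo s o1 + xpo s o2 + xpo s o3 = D)%N.
Proof.
rewrite /xpo; have := valP (enum_val s); rewrite inE.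
case: (val (enum_val s)) => -[|a [|b [|c [|d [|]]]]] // h.
by rewrite !big_cons big_nil /= !(tnth_nth ord0) /= => /eqP; lia.
Qed.

Lemma ex_inj D (s s' : 'I_(nmono D)) : xpo s o0 = xpo s' o0 -> xpo s o1 = xpo s' o1 ->
  xpo s o2 = xpo s' o2 -> xpo s o3 = xpo s' o3 -> s = s'.
Proof.
move=> h0 h1 h2 h3; apply: enum_val_inj; apply: val_inj; apply: eq_from_tnth => i.
apply: val_inj; case: i => -[|[|[|[|]]]] // hi.
- by move: h0; rewrite /xpo /o0 (bool_irrelevance hi isT).
- by move: h1; rewrite /xpo /o1 (bool_irrelevance hi isT).
- by move: h2; rewrite /xpo /o2 (bool_irrelevance hi isT).
- by move: h3; rewrite /xpo /o3 (bool_irrelevance hi isT).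
Qed.

Lemma ex_surj D a b c d : (a + b + c + d = D)%N ->
  exists s : 'I_(nmono D), [/\ xpo s o0 = a, xpo s o1 = b, xpo s o2 = c & xpo s o3 = d].
Proof.
move=> e; pose t : 4.-tuple 'I_D.+1 := [tuple inord a; inord b; inord c; inord d].
have ht : t \in [set t : 4.-tuple 'I_D.+1 | (\sum_(i <- t) i == D)%N].
  by rewrite inE !big_cons big_nil /= !inordK; lia.
exists (enum_rank (exist _ t ht : expo D)).
by split; rewrite /xpo enum_rankK /= (tnth_nth ord0) /= inordK //; lia.
Qed.

Definition exm D (s : 'I_(nmono D)) : S := mono (xpo s o0) (xpo s o1) (xpo s o2) (xpo s o3).

Definition vec D P : 'rV[k]_(nmono D) :=
  \row_s cf P (xpo s o0) (xpo s o1) (xpo s o2) (xpo s o3).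
Definition pol D (v : 'rV[k]_(nmono D)) : S := \sum_s cst (v 0 s) * exm s.

Lemma vecD D P Q : vec D (P + Q) = vec D P + vec D Q.
Proof. by apply/rowP => s; rewrite !mxE cfD. Qed.

Lemma vecZ D x P : vec D (cst x * P) = x *: vec D P.
Proof. by apply/rowP => s; rewrite !mxE cf_cstM. Qed.

Lemma vec0 D : vec D 0 = 0.
Proof. by apply/rowP => s; rewrite !mxE cf0. Qed.

Lemma vecN D P : vec D (- P) = - vec D P.
Proof. by apply/rowP => s; rewrite !mxE cfN. Qed.

Lemma vec_sum D (I : finType) (F : I -> S) :
  vec D (\sum_i F i) = \sum_i vec D (F i).
Proof. by elim/big_rec2: _ => [|i x y _ <-]; rewrite ?vec0 ?vecD. Qed.

Lemma vec_exm D (s : 'I_(nmono D)) : vec D (exm s) = delta_mx 0 s.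
Proof.
apply/rowP => s'; rewrite !mxE cf_mono /=; congr (_%:R); congr nat_of_bool.
apply/idP/idP => [/andP[/andP[/andP[/eqP h0 /eqP h1] /eqP h2] /eqP h3]|/eqP ->].
  by apply/eqP; apply: ex_inj.
by rewrite !eqxx.
Qed.

Lemma polK D v : vec D (pol v) = v.
Proof.
rewrite vec_sum [RHS]row_sum_delta; apply: eq_bigr => s _.
by rewrite vecZ vec_exm.
Qed.

Lemma hom_mono D a b c d : (a + b + c + d = D)%N -> hom D (mono a b c d).
Proof. by move=> e; rewrite -e -wdeg_tot; apply: whomog_mono. Qed.

Lemma hom_exm D (s : 'I_(nmono D)) : hom D (exm s).
Proof. by apply: hom_mono; apply: ex_sum. Qed.

Lemma hom_cstM D x P : hom D P -> hom D (cst x * P).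
Proof. by move=> h; apply: (whomogM (i := 0)) h; apply: whomog_cst. Qed.

Lemma hom_pol D v : hom D (pol (D := D) v).
Proof.
rewrite /pol; apply: (big_ind (hom D)) => [||s _]; first exact: whomog0.
  exact: whomogD.
by apply: hom_cstM; apply: hom_exm.
Qed.

Lemma vec_inj D P Q : hom D P -> hom D Q -> vec D P = vec D Q -> P = Q.
Proof.
move=> hP hQ e; apply: cfP => a b c d.
have [h|h] := eqVneq (a + b + c + d)%N D.
  have [s [e0 e1 e2 e3]] := ex_surj h.
  by move/rowP/(_ s): e; rewrite !mxE e0 e1 e2 e3.
have z R : hom D R -> cf R a b c d = 0.
  move=> hR; apply/eqP; apply: contraNT h => /hR <-.
  by rewrite wdeg_tot.
by rewrite !z.
Qed.

Lemma vecK D P : hom D P -> pol (vec D P) = P.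
Proof. by move=> h; apply: (@vec_inj D) => //; [apply: hom_pol|apply: polK]. Qed.

(** Multiplication by [f] on row vectors of coefficients. Stacking the matrices of [f] and [g] in
    suitable degrees gives a matrix whose row space is a graded piece of (f, g). *)
Definition mulM f D' D : 'M[k]_(nmono D', nmono D) := \matrix_s vec D (f * exm s).

Lemma mulME f D' D v : v *m mulM f D' D = vec D (f * pol v).
Proof.
rewrite mulmx_sum_row /pol mulr_sumr vec_sum; apply: eq_bigr => s _.
by rewrite rowK -vecZ mulrCA.
Qed.

Lemma mulM_vec f D' D P : hom D' P -> vec D' P *m mulM f D' D = vec D (f * P).
Proof. by move=> h; rewrite mulME vecK. Qed.

Lemma mulM_free f d D' D : f != 0 -> hom d f -> (D = D' + d)%N -> row_free (mulM f D' D).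
Proof.
move=> f0 hf e; apply/inj_row_free => v; rewrite mulME => h.
have : f * pol v = 0.
  apply: (@vec_inj D); rewrite ?vec0 //; last exact: whomog0.
  by rewrite e addnC; apply: whomogM => //; apply: hom_pol.
move/eqP; rewrite mulf_eq0 (negbTE f0) /= => /eqP h0.
by rewrite -(polK v) h0 vec0.
Qed.

Lemma mulM_mul f g d D1 D2 D3 : hom d g -> (D2 = D1 + d)%N ->
  mulM g D1 D2 *m mulM f D2 D3 = mulM (f * g) D1 D3.
Proof.
move=> hg e; apply/row_matrixP => s; rewrite row_mul !rowK mulM_vec ?mulrA //.
by rewrite e addnC; apply: whomogM => //; apply: hom_exm.
Qed.

Definition koszul f g d1 d2 D :=
  row_mx (mulM g D (D + d2)) (- mulM f D (D + d1)).

Lemma koszul_mul f g d1 d2 D : hom d1 f -> hom d2 g ->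
  koszul f g d1 d2 D *m
  col_mx (mulM f (D + d2) (D + d1 + d2)) (mulM g (D + d1) (D + d1 + d2)) = 0.
Proof.
move=> hf hg; rewrite mul_row_col mulNmx (mulM_mul _ _ hg) // (mulM_mul _ _ hf) //.
by rewrite mulrC subrr.
Qed.

(** The Koszul syzygies (g v, -f v), with v of degree [D], lie in the kernel, and v is recovered
    from them because [f] is nonzero. *)
Lemma rank_ideal_le f g d1 d2 D : f != 0 -> hom d1 f -> hom d2 g ->
  (\rank (col_mx (mulM f (D + d2) (D + d1 + d2)) (mulM g (D + d1) (D + d1 + d2)))
   + nmono D <= nmono (D + d2) + nmono (D + d1))%N.
Proof.
move=> f0 hf hg; have := mulmx0_rank_max (koszul_mul D hf hg).
suff -> : \rank (koszul f g d1 d2 D) = nmono D by rewrite addnC.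
apply/eqP; rewrite -/(row_free _); apply/inj_row_free => v.
rewrite mul_mx_row => h; have := congr1 rsubmx h.
rewrite row_mxKr mulmxN linear0 => /eqP; rewrite oppr_eq0 => /eqP h1.
have /row_freeP[B hB] := mulM_free f0 hf (erefl (D + d1)%N).
by rewrite -[v]mulmx1 -hB mulmxA h1 mul0mx.
Qed.

(** For coprime [a] and [b] every syzygy is a Koszul one, so the kernel has dimension at most
    [nmono D]. *)
Lemma rank_ideal_ge a b al be D : b != 0 -> hom al a -> hom be b -> coprime_elts a b ->
  (nmono (D + be) + nmono (D + al) <=
   \rank (col_mx (mulM a (D + be) (D + al + be)) (mulM b (D + al) (D + al + be)))
   + nmono D)%N.
Proof.
move=> b0 ha hb co; set U := col_mx _ _.
have kerK : (kermx U <= koszul a b al be D)%MS.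
  apply/rV_subP => v /sub_kermxP; rewrite -[v]hsubmxK mul_row_col !mulME -vecD.
  set v1 := lsubmx v; set v2 := rsubmx v => h.
  have e : a * pol v1 + b * pol v2 = 0.
    apply: (@vec_inj (D + al + be)); rewrite ?vec0 //; last exact: whomog0.
    apply: whomogD.
      by rewrite (_ : D + al + be = al + (D + be))%N; [apply: whomogM ha (@hom_pol _ v1)|lia].
    by rewrite (_ : D + al + be = be + (D + al))%N; [apply: whomogM hb (@hom_pol _ v2)|lia].
  have [|q eq] := @coprime_syzygy S a b (pol v1) (- pol v2) (@poly4_factorial k S) b0 co.
    by apply/eqP; rewrite -subr_eq0 mulrN opprK e.
  (* The quotient [q] is not known to be homogeneous; its component of degree [D] serves as well. *)
  pose q1 := hcomp otot D q.
  have e1 : pol v1 = b * q1.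
    by rewrite -(hcomp_id (@hom_pol _ v1)) eq mulrC (hcompM _ _ hb) mulrC.
  have e2 : pol v2 = - (a * q1).
    apply: (mulfI b0); apply/eqP; rewrite -subr_eq0 mulrN opprK; apply/eqP.
    by rewrite -[RHS]e e1; ring.
  apply/submxP; exists (vec D q1).
  have hq1 : hom D q1 by apply: whomog_hcomp.
  rewrite /koszul mul_mx_row mulmxN !mulM_vec //; congr row_mx.
    by rewrite -e1 polK.
  by rewrite -vecN -e2 polK.
have := mxrankS kerK; rewrite mxrank_ker.
have := rank_leq_row (koszul a b al be D); rewrite leq_subLR; lia.
Qed.

(** Passing to leading forms does not raise the dimension: elements with linearly independent
    leading forms are linearly independent. *)
Lemma rank_lead_le o r r' D (W : 'M[k]_(r, nmono D)) (U : 'M[k]_(r', nmono D)) :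
  (forall i, exists v, [/\ hom D v, (vec D v <= U)%MS & row i W = vec D (lc o v)]) ->
  (\rank W <= \rank U)%N.
Proof.
move=> H; have [v hv] := fin_all_exists H.
set r0 := \rank W; pose phi := maxrankfun W.
pose V := \matrix_(j < r0) vec D (v (phi j)).
have VU : (V <= U)%MS.
  by apply/row_subP => j; rewrite rowK; have [] := hv (phi j).
suff freeV : row_free V by have := mxrankS VU; rewrite (eqP freeV).
apply/inj_row_free => c; rewrite mulmx_sum_row => hc.
have sum0 : \sum_j cst (c 0 j) * v (phi j) = 0.
  apply: (@vec_inj D); last first.
  - rewrite vec0 -[RHS]hc vec_sum; apply: eq_bigr => j _.
    by rewrite rowK vecZ.
  - exact: whomog0.
  apply: (big_ind (hom D)) => [||j _]; first exact: whomog0.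
    exact: whomogD.
  by apply: hom_cstM; have [] := hv (phi j).
apply/rowP => j0; rewrite mxE; apply/eqP; apply: contraT => cj0.
pose sz j := size (Gam S o (v (phi j))).
have [j1 cj1 jmax] := @arg_maxnP _ j0 (fun j => c 0 j != 0) sz cj0.
(* Among the terms with nonzero coefficient, those of greatest leading degree are kept; the
   component of that degree in the relation is a relation between their leading forms. *)
pose c' : 'rV[k]_r0 := \row_j (if (sz j == sz j1) then c 0 j else 0).
have c'0 : c' = 0.
  have freeW := maxrowsub_free W.
  have /row_freeP[B hB] := freeW.
  rewrite -[c']mulmx1 -hB mulmxA (_ : c' *m _ = 0) ?mul0mx //.
  rewrite mulmx_sum_row.
  have : vec D (\sum_j cst (c' 0 j) * lc o (v (phi j))) = 0.
    rewrite (_ : \sum_j _ = 0) ?vec0 //.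
    have := congr1 (fun P => hcomp o (sz j1).-1 P) sum0.
    rewrite /= /hcomp rmorph0 coef0 => h; rewrite -[RHS]h {h}.
    rewrite rmorph_sum coef_sum; apply: eq_bigr => j _; rewrite mxE.
    have /whomogP eG : whomog o 0 (cst (c 0 j) : S) by apply: whomog_cst.
    rewrite rmorphM /= eG expr0 mulr1 coefCM.
    have [cj|cj] := eqVneq (c 0 j) 0; first by rewrite cj if_same rmorph0 !mul0r.
    have : (sz j <= sz j1)%N := jmax j cj.
    rewrite leq_eqVlt => /orP[/eqP ej|lj].
      by rewrite ej eqxx /lc lead_coefE -/(sz j) ej.
    rewrite ltn_eqF // rmorph0 mul0r nth_default ?mulr0 //.
    by rewrite -/(sz j); move: lj; case: (sz j1).
  rewrite vec_sum => h; rewrite -[RHS]h; apply: eq_bigr => j _.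
  by rewrite row_rowsub vecZ; have [_ _ ->] := hv (phi j).
by move/rowP/(_ j1): c'0; rewrite !mxE eqxx => /eqP; rewrite (negbTE cj1).
Qed.

End Count.

(** * The degree of the gcd of the extremal forms *)

Section Gcd.
Variables (k : fieldType) (S : poly4 k).
Implicit Types P Q : S.
Local Notation hom := (@whomog k S otot).

(** The degree in x and y alone, which drops when x^4 is replaced by w^3 z or y^4 by w z^3. *)
Definition xylt e P : Prop := forall a b c d, cf P a b c d != 0 -> (b + c < e)%N.

Lemma xylt_mono e P e' : (e <= e')%N -> xylt e P -> xylt e' P.
Proof. by move=> h H a b c d /H; lia. Qed.

Lemma xyltD e P Q : xylt e P -> xylt e Q -> xylt e (P + Q).
Proof.
move=> hP hQ a b c d; rewrite cfD => h.
have [e0|/hP//] := eqVneq (cf P a b c d) 0.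
by move: h; rewrite e0 add0r => /hQ.
Qed.

Lemma xyltN e P : xylt e P -> xylt e (- P).
Proof. by move=> hP a b c d; rewrite cfN oppr_eq0 => /hP. Qed.

Lemma xylt_cst_mono e t a b c d : (b + c < e)%N -> xylt e (cst t * mono a b c d : S).
Proof.
move=> h a' b' c' d'; rewrite cf_cstM cf_mono.
by case: andP => [[/andP[/andP[_ /eqP-> /eqP->]]]|] //; rewrite mulr0 eqxx.
Qed.

Lemma xylt_monoM e P a b c d : xylt e P -> xylt (e + b + c) (P * mono a b c d).
Proof.
move=> hP; apply: (@poly4_supp_ind k S (fun P => xylt (e + b + c) (P * mono a b c d))).
- by rewrite mul0r => a' b' c' d'; rewrite cf0 eqxx.
- by move=> u v hu hv; rewrite mulrDl; apply: xyltD.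
move=> a' b' c' d' /hP h; rewrite -mulrA monoM; apply: xylt_cst_mono; lia.
Qed.

(** Every term of the expansion other than the first contains the second monomial, which is free of
    x and y. *)
Lemma xylt_pow (p q i j N : nat) : (0 < p + q)%N ->
  xylt ((p + q) * N) ((mono 0 p q 0 - mono i 0 0 j) ^+ N - mono 0 p q 0 ^+ N).
Proof.
move=> pq0; set m1 := mono 0 p q 0; set m2 := mono i 0 0 j.
elim: N => [|N IH]; first by move=> a b c d; rewrite !expr0 subrr cf0 eqxx.
rewrite (_ : _ - _ = ((m1 - m2) ^+ N - m1 ^+ N) * m1
    + - ((((m1 - m2) ^+ N - m1 ^+ N) + m1 ^+ N) * m2)); last by rewrite !exprS; ring.
apply: xyltD; first by apply: xylt_mono (xylt_monoM IH); lia.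
apply: xyltN; rewrite mulrDl; apply: xyltD.
  by apply: xylt_mono (xylt_monoM IH); lia.
rewrite monoX monoM -[mono _ _ _ _]mul1r -(rmorph1 cst).
apply: xylt_cst_mono; lia.
Qed.

Definition inI (f g P : S) : Prop := exists A B, P = A * f + B * g.

Lemma inIM f g P Q : inI f g P -> inI f g (P * Q).
Proof. by move=> [A [B ->]]; exists (A * Q), (B * Q); ring. Qed.

Section Space.
Variables (o : weight) (f g : S) (d1 d2 : nat).
Hypotheses (hf : hom d1 f) (hg : hom d2 g).
Variables (D0 Ef Eg E : nat).
Hypotheses (eEf : Ef = (D0 + d2)%N) (eEg : Eg = (D0 + d1)%N) (eE : E = (D0 + d1 + d2)%N).

Let U := col_mx (mulM f Ef E) (mulM g Eg E).

Lemma inI_sub v : hom E v -> inI f g v -> (vec E v <= U)%MS.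
Proof.
move=> hv [A [B e]].
have e1 : v = f * hcomp otot Ef A + g * hcomp otot Eg B.
  rewrite -(hcomp_id hv) e hcompD.
  rewrite {1}(_ : E = Ef + d1)%N; last by lia.
  rewrite {1}(_ : E = Eg + d2)%N; last by lia.
  by rewrite (hcompM _ _ hf) (hcompM _ _ hg) mulrC [_ * g]mulrC.
rewrite e1 vecD -(@mulM_vec _ _ f Ef E); last exact: whomog_hcomp.
rewrite -(@mulM_vec _ _ g Eg E); last exact: whomog_hcomp.
by rewrite -mul_row_col submxMl.
Qed.

Definition init_rows r (W : 'M[k]_(r, nmono E)) : Prop := forall i, exists v,
  [/\ hom E v, (vec E v <= U)%MS & row i W = vec E (lc o v)].

Lemma init_rows_col r r' (W : 'M[k]_(r, nmono E)) (W' : 'M[k]_(r', nmono E)) :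
  init_rows W -> init_rows W' -> init_rows (col_mx W W').
Proof.
move=> hW hW' i; rewrite -[i]splitK; case: (split i) => j /=.
  by rewrite rowKu.
by rewrite rowKd.
Qed.

(** Leading forms are multiplicative and a monomial is its own leading form, so multiples of [u] by
    monomials are leading forms of multiples of [v]. *)
Lemma init_rows_mulM u v e D' : hom e v -> inI f g v -> lc o v = u -> (E = D' + e)%N ->
  init_rows (mulM u D' E).
Proof.
move=> hv iv ev eD i; exists (v * exm S i).
have hvi : hom E (v * exm S i).
  by rewrite eD addnC; apply: whomogM hv _; apply: hom_exm.
split=> //; first by apply: inI_sub => //; apply: inIM.
by rewrite rowK lcM ev [lc o (exm S i)](lc_id (@whomog_mono _ _ _ _ _ _ _)).
Qed.

End Space.

(** Six times the mixed second difference of [nmono] is 3 tau sg (2x + sg + tau + 4), which is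
    unbounded in x; at x = C + B it already exceeds 6C. *)
Lemma nmono_growth tau sg C B : (0 < tau)%N -> (0 < sg)%N ->
  ~ (forall x, (B <= x)%N ->
     nmono (x + sg + tau) + nmono x <= C + (nmono (x + sg) + nmono (x + tau)))%N.
Proof.
move=> t0 s0 /(_ (C + B)%N (leq_addl _ _)); move: (C + B)%N (leq_addr B C) => X hX.
have h1 := nmono6 (X + sg + tau); have h2 := nmono6 X.
have h3 := nmono6 (X + sg); have h4 := nmono6 (X + tau).
move: (nmono _) (nmono _) (nmono _) (nmono _) h1 h2 h3 h4 => n1 n2 n3 n4 h1 h2 h3 h4 h.
have e : ((X + sg + tau + 1) * (X + sg + tau + 2) * (X + sg + tau + 3) +
  (X + 1) * (X + 2) * (X + 3) = (X + sg + 1) * (X + sg + 2) * (X + sg + 3) +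
  (X + tau + 1) * (X + tau + 2) * (X + tau + 3) +
  3 * (tau * sg) * (2 * X + sg + tau + 4))%N by lia.
have ts0 : (0 < tau * sg)%N by rewrite muln_gt0 t0.
have h5 := leq_pmull (2 * X + sg + tau + 4)%N ts0.
lia.
Qed.

Lemma rank_ideal_le_eq f g d1 d2 D Ef Eg E : f != 0 -> hom d1 f -> hom d2 g ->
  Ef = (D + d2)%N -> Eg = (D + d1)%N -> E = (D + d1 + d2)%N ->
  (\rank (col_mx (mulM f Ef E) (mulM g Eg E)) + nmono D <= nmono Ef + nmono Eg)%N.
Proof. by move=> f0 hf hg -> -> ->; apply: rank_ideal_le. Qed.

Lemma rank_ideal_ge_eq a b al be D Ea Eb E : b != 0 -> hom al a -> hom be b ->
  coprime_elts a b -> Ea = (D + be)%N -> Eb = (D + al)%N -> E = (D + al + be)%N ->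
  (nmono Ea + nmono Eb <= \rank (col_mx (mulM a Ea E) (mulM b Eb E)) + nmono D)%N.
Proof. by move=> b0 ha hb co -> -> ->; apply: rank_ideal_ge. Qed.

(* Modulo q1^N1 and q2^N2 the x- and y-exponents are bounded; modulo h^N3 and t so is the
   w- or the z-exponent. *)
Lemma spanning (K : S -> Prop) t kap (i j tau N1 N2 N3 E : nat) :
  let q1 := mono 0 4 0 0 - mono 3 0 0 1 : S in
  let q2 := mono 0 0 4 0 - mono 1 0 0 3 : S in
  let h := t ^+ 4 - cst kap * mono i 0 0 j in
  K 0 -> (forall u v, K u -> K v -> K (u + v)) -> (forall x P, K P -> K (cst x * P)) ->
  (forall P, hom (E - 4 * N1) P -> K (q1 ^+ N1 * P)) ->
  (forall P, hom (E - 4 * N2) P -> K (q2 ^+ N2 * P)) ->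
  (forall P, hom (E - 4 * tau * N3) P -> K (h ^+ N3 * P)) ->
  (forall Z, hom E (t * Z) -> K (t * Z)) ->
  (forall a b c d, (b < 4 * N1)%N -> (c < 4 * N2)%N -> (a + b + c + d = E)%N ->
    ((a < i * N3) || (d < j * N3))%N -> K (mono a b c d)) ->
  hom 4 q1 -> hom 4 q2 -> hom (4 * tau) h -> kap != 0 -> (i + j = 4 * tau)%N ->
  (4 * N1 <= E)%N -> (4 * N2 <= E)%N -> (4 * tau * N3 <= E)%N ->
  forall n P, hom E P -> xylt n P -> K P.
Proof.
move=> q1 q2 h K0 KD KZ Kq1 Kq2 Kh Kt KC hq1 hq2 hhh kap0 eij E1 E2 E3 n P.
pose M := (i * N3)%N; pose M' := (j * N3)%N.
  elim: n P => [|n IH] P hP xP.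
    have -> : P = 0.
      apply: cfP => a' b' c' d'; rewrite cf0; apply/eqP; apply: contraT => /xP.
      by rewrite ltn0.
    exact: K0.
  apply: (@poly4_supp_ind k S K) => //.
  move=> a' b' c' d' cP; apply: (KZ).
  have := hP _ _ _ _ cP; rewrite wdeg_tot => es; have hbc := xP _ _ _ _ cP.
  have [hb'|hb'] := leqP (4 * N1) b'.
    pose m := mono a' (b' - 4 * N1) c' d' : S.
    have hm : hom (E - 4 * N1) m by apply: hom_mono; lia.
    (* The monomial is a multiple of [q1 ^+ N1] up to terms of lower degree in x and y, left to the
       induction. *)
    have em : mono a' b' c' d' = q1 ^+ N1 * m - (q1 ^+ N1 - mono 0 4 0 0 ^+ N1) * m.
      rewrite -mulrBl opprB addrC subrK monoX monoM; congr mono; lia.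
    rewrite em; apply: (KD); first exact: Kq1.
    rewrite -mulN1r -(rmorph1 cst) -rmorphN; apply: (KZ); apply: IH.
      rewrite mulrBl; apply: whomogD.
        rewrite (_ : E = 4 * N1 + (E - 4 * N1))%N; last by lia.
        by apply: whomogM hm; apply: whomogX.
      by apply: whomogN; rewrite monoX monoM; apply: hom_mono; lia.
    by apply: xylt_mono (xylt_monoM (@xylt_pow 4 0 3 1 N1 isT)); lia.
  have [hc'|hc'] := leqP (4 * N2) c'.
    pose m := mono a' b' (c' - 4 * N2) d' : S.
    have hm : hom (E - 4 * N2) m by apply: hom_mono; lia.
    have em : mono a' b' c' d' = q2 ^+ N2 * m - (q2 ^+ N2 - mono 0 0 4 0 ^+ N2) * m.
      rewrite -mulrBl opprB addrC subrK monoX monoM; congr mono; lia.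
    rewrite em; apply: (KD); first exact: Kq2.
    rewrite -mulN1r -(rmorph1 cst) -rmorphN; apply: (KZ); apply: IH.
      rewrite mulrBl; apply: whomogD.
        rewrite (_ : E = 4 * N2 + (E - 4 * N2))%N; last by lia.
        by apply: whomogM hm; apply: whomogX.
      by apply: whomogN; rewrite monoX monoM; apply: hom_mono; lia.
    by apply: xylt_mono (xylt_monoM (@xylt_pow 0 4 1 3 N2 isT)); lia.
  have [had|] := boolP ((a' < M) || (d' < M'))%N; first exact: KC.
  rewrite negb_or -!leqNgt => /andP[haM hdM].
  pose m := mono (a' - M) b' c' (d' - M') : S.
  pose mu := cst kap * mono i 0 0 j : S.
  (* Modulo [t], the power [h ^+ N3] is a nonzero constant times w^M z^M', so any monomial divisible
     by the latter lies in the span. *)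
  have [Y eY] : exists Y, h ^+ N3 - (- mu) ^+ N3 = t * Y.
    exists (t ^+ 3 * \sum_(l < N3) h ^+ (N3.-1 - l) * (- mu) ^+ l).
    by rewrite subrXX mulrA -exprS; congr (_ * _); rewrite /h -/mu; ring.
  have hm : hom (E - 4 * tau * N3) m.
    by apply: hom_mono; rewrite -eij; rewrite /M /M' in haM hdM *; lia.
  have hmu : (- mu) ^+ N3 * m = cst ((- kap) ^+ N3) * mono a' b' c' d'.
    rewrite /mu -mulNr -rmorphN exprMn -rmorphXn -mulrA monoX monoM.
    by congr (_ * mono _ _ _ _); rewrite /M /M' in haM hdM *; lia.
  have kN : (- kap) ^+ N3 != 0 by rewrite expf_neq0 // oppr_eq0.
  have -> : mono a' b' c' d' = cst ((- kap) ^+ N3)^-1 * ((- mu) ^+ N3 * m).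
    by rewrite hmu mulrA -rmorphM mulVf // rmorph1 mul1r.
  apply: (KZ).
  have e3 : (- mu) ^+ N3 * m = h ^+ N3 * m + t * (- (Y * m)).
    by rewrite mulrN mulrA -eY; ring.
  rewrite e3; apply: (KD); first exact: Kh.
  apply: Kt.
  have -> : t * - (Y * m) = (- mu) ^+ N3 * m - h ^+ N3 * m by rewrite e3; ring.
  apply: whomogD.
    by rewrite hmu; apply: hom_cstM; apply: hom_mono.
  apply: whomogN; rewrite (_ : E = 4 * tau * N3 + (E - 4 * tau * N3))%N; last by lia.
  by apply: whomogM hm; apply: whomogX.
Qed.

(** In degree [E] the larger one of the w- and z-exponents need not be recorded, so the remaining
    monomials are indexed by a set independent of [E]. *)
Lemma mono_side (E M M' a b c d : nat) : (a + b + c + d = E)%N ->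
  ((a < M) || (d < M'))%N -> exists l side, (l < M + M')%N /\
    mono a b c d = (let r := (E - (b + c + l))%N in
      if side then mono l b c r else mono r b c l : S).
Proof.
move=> es /orP[had|had].
  by exists a, true; split; [lia|congr mono; lia].
by exists d, false; split; [lia|congr mono; lia].
Qed.

(** In degree [E] the leading forms [W], the leftover monomials [Cm] and the multiples [T] of [t]
    span everything, whence nmono E <= rank W + #|I| + nmono E2 - rank J. Inserting rank W <= rank U
    and the Koszul bounds on the ranks of [U] and [J] gives an inequality that [nmono_growth]
    refutes. *)
Lemma gcd_degree0 o f g d1 d2 t a b tau al be e kap (i j N1 N2 N3 : nat) :
  let q1 := mono 0 4 0 0 - mono 3 0 0 1 : S in
  let q2 := mono 0 0 4 0 - mono 1 0 0 3 : S in
  let h := t ^+ 4 - cst kap * mono i 0 0 j in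
  hom d1 f -> hom d2 g -> (0 < d1)%N -> (0 < d2)%N -> f != 0 -> g != 0 ->
  lc o f = t * a -> lc o g = t * b -> hom tau t -> hom al a -> hom be b ->
  (d1 = tau + al)%N -> (d2 = tau + be)%N -> coprime_elts a b ->
  o = ow1 \/ o = ow2 -> whomog o e h -> kap != 0 -> (i + j = 4 * tau)%N ->
  inI f g (q1 ^+ N1) -> inI f g (q2 ^+ N2) -> inI f g (h ^+ N3) -> tau = 0%N.
Proof.
move=> q1 q2 h hf hg d10 d20 f0 g0 ef eg ht ha hb ed1 ed2 co ho hh kap0 eij i1 i2 i3.
apply/eqP; rewrite -leqn0 leqNgt; apply/negP => tau0.
pose M := (i * N3)%N; pose M' := (j * N3)%N.
pose I : finType := ('I_(4 * N1) * 'I_(4 * N2) * 'I_(M + M') * bool)%type.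
pose B := (4 * N1 + 4 * N2 + 4 * tau * N3)%N.
pose Cst := (#|I|)%N.
have hq1 : hom 4 q1.
  by apply: whomogD; [|apply: whomogN]; apply: hom_mono.
have hq2 : hom 4 q2.
  by apply: whomogD; [|apply: whomogN]; apply: hom_mono.
have hhh : hom (4 * tau) h.
  apply: whomogD; first by rewrite mulnC; apply: whomogX.
  by apply: whomogN; apply: hom_cstM; apply: hom_mono; lia.
have oq1 : exists e1, whomog o e1 q1.
  exists (wdeg o 0 4 0 0); apply: whomogD; first exact: whomog_mono.
  rewrite (_ : wdeg o 0 4 0 0 = wdeg o 3 0 0 1).
    by apply: whomogN; apply: whomog_mono.
  by case: ho => ->; rewrite /wdeg.
have oq2 : exists e1, whomog o e1 q2.
  exists (wdeg o 0 0 4 0); apply: whomogD; first exact: whomog_mono.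
  rewrite (_ : wdeg o 0 0 4 0 = wdeg o 1 0 0 3).
    by apply: whomogN; apply: whomog_mono.
  by case: ho => ->; rewrite /wdeg.
have b0 : b != 0 by move: g0; rewrite -(lc_eq0 o) eg mulf_eq0 negb_or => /andP[].
have t0 : t != 0 by move: g0; rewrite -(lc_eq0 o) eg mulf_eq0 negb_or => /andP[].
apply: (@nmono_growth tau (tau + al + be) #|I| B) => // [|x hx]; first by lia.
(* The degrees become variables tied by equations, so that the matrix types agree without casts. *)
have [Ef eEf] : exists n, n = (x + d2)%N by exists (x + d2)%N.
have [Eg eEg] : exists n, n = (x + d1)%N by exists (x + d1)%N.
have [E2 eE2] : exists n, n = (x + (tau + al + be))%N by exists (x + (tau + al + be))%N.
rewrite -eE2; have [E eE2'] : exists n, n = (E2 + tau)%N by exists (E2 + tau)%N.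
rewrite -eE2'; have eE : E = (x + d1 + d2)%N by lia.
have eE2a : E2 = (Ef + al)%N by lia.
have eE2b : E2 = (Eg + be)%N by lia.
pose U := col_mx (mulM f Ef E) (mulM g Eg E).
pose J := col_mx (mulM a Ef E2) (mulM b Eg E2).
have rU : (\rank U + nmono x <= nmono Ef + nmono Eg)%N.
  exact: (rank_ideal_le_eq f0 hf hg).
have rJ : (nmono Ef + nmono Eg <= \rank J + nmono (x + tau))%N.
  by apply: (rank_ideal_ge_eq b0 ha hb co); lia.
have [D1 eD1] : exists n, n = (E - 4 * N1)%N by exists (E - 4 * N1)%N.
have [D2 eD2] : exists n, n = (E - 4 * N2)%N by exists (E - 4 * N2)%N.
have [D3 eD3] : exists n, n = (E - 4 * tau * N3)%N by exists (E - 4 * tau * N3)%N.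
pose W3 := mulM (h ^+ N3) D3 E.
pose W2 := col_mx (mulM (q2 ^+ N2) D2 E) W3.
pose W1 := col_mx (mulM (q1 ^+ N1) D1 E) W2.
pose WG := col_mx (mulM (t * b) Eg E) W1.
pose W := col_mx (mulM (t * a) Ef E) WG.
have pow_lc e1 u N : whomog o e1 u -> lc o (u ^+ N) = u ^+ N.
  by move=> hu; apply: (@lc_id _ _ _ (e1 * N)); apply: whomogX.
have rW : (\rank W <= \rank U)%N.
  apply: (@rank_lead_le _ _ o).
  have initP := @init_rows_mulM o f g d1 d2 hf hg x Ef Eg E eEf eEg eE.
  apply: init_rows_col.
    by apply: (initP _ f d1) => //; [exists 1, 0; ring|lia].
  apply: init_rows_col.
    by apply: (initP _ g d2) => //; [exists 0, 1; ring|lia].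
  apply: init_rows_col.
    have [e1 h1] := oq1.
    apply: (initP _ (q1 ^+ N1) (4 * N1)%N) => //; [exact: whomogX|exact: pow_lc h1|].
    by lia.
  apply: init_rows_col.
    have [e1 h1] := oq2.
    apply: (initP _ (q2 ^+ N2) (4 * N2)%N) => //; [exact: whomogX|exact: pow_lc h1|].
    by lia.
  apply: (initP _ (h ^+ N3) (4 * tau * N3)%N) => //; [exact: whomogX|exact: pow_lc hh|].
  by lia.
pose Cm : 'M[k]_(#|I|, nmono E) := \matrix_s
  let: (b', c', l, side) := (enum_val s : I) in
  let r := (E - (b' + c' + l))%N in
  vec E (if side then mono l b' c' r else mono r b' c' l : S).
(* Multiples of [t] need only be added for cofactors complementary to [J]: the other ones are
   already multiples of t a and t b. *)
pose T := (J^C)%MS *m mulM t E2 E.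
pose V := (W + (Cm + T))%MS.
have WV : (W <= V)%MS by apply: addsmxSl.
have sub_l r1 r2 (X1 : 'M[k]_(r1, nmono E)) (X2 : 'M[k]_(r2, nmono E)) :
    (X1 <= col_mx X1 X2)%MS by rewrite -addsmxE addsmxSl.
have sub_r r1 r2 (X1 : 'M[k]_(r1, nmono E)) (X2 : 'M[k]_(r2, nmono E)) :
    (X2 <= col_mx X1 X2)%MS by rewrite -addsmxE addsmxSr.
have Wta : (mulM (t * a) Ef E <= W)%MS by apply: sub_l.
have sWG : (WG <= W)%MS by apply: sub_r.
have Wtb : (mulM (t * b) Eg E <= W)%MS by apply: submx_trans sWG; apply: sub_l.
have sW1 : (W1 <= W)%MS by apply: submx_trans sWG; apply: sub_r.
have Wq1 : (mulM (q1 ^+ N1) D1 E <= W)%MS by apply: submx_trans sW1; apply: sub_l.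
have sW2 : (W2 <= W)%MS by apply: submx_trans sW1; apply: sub_r.
have Wq2 : (mulM (q2 ^+ N2) D2 E <= W)%MS by apply: submx_trans sW2; apply: sub_l.
have Wh : (mulM (h ^+ N3) D3 E <= W)%MS by apply: submx_trans sW2; apply: sub_r.
have subM u D' P : (mulM u D' E <= W)%MS -> hom D' P -> (vec E (u * P) <= V)%MS.
  move=> hu hP; rewrite -(@mulM_vec _ _ u D' E) //.
  by apply: submx_trans (submx_trans hu WV); apply: submxMl.
have subt Z : hom E (t * Z) -> (vec E (t * Z) <= V)%MS.
  move=> hZ; pose Z' := hcomp otot E2 Z.
  have hZ' : hom E2 Z' by apply: whomog_hcomp.
  have -> : t * Z = t * Z'.
    by rewrite -(hcomp_id hZ) eE2' mulrC (hcompM _ _ ht) mulrC.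
  rewrite -(@mulM_vec _ _ t E2 E) //.
  have /sub_addsmxP[[u1 u2] /= ->] : (vec E2 Z' <= J + J^C)%MS.
    by apply: submx_full; apply: addsmx_compl_full.
  rewrite mulmxDl; apply: addmx_sub.
    apply: submx_trans WV; rewrite -mulmxA; apply: mulmx_sub.
    rewrite /J mul_col_mx (mulM_mul _ _ ha) //.
    rewrite (mulM_mul _ _ hb) //.
    by rewrite -addsmxE addsmx_sub Wta.
  apply: submx_trans (addsmxSr _ _); apply: submx_trans (addsmxSr _ _).
  by rewrite -mulmxA submxMl.
have subC a' b' c' d' : (b' < 4 * N1)%N -> (c' < 4 * N2)%N -> (a' + b' + c' + d' = E)%N ->
    ((a' < M) || (d' < M'))%N -> (vec E (mono a' b' c' d' : S) <= V)%MS.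
  move=> hb' hc' es had; apply: submx_trans (addsmxSr _ _).
  apply: submx_trans (addsmxSl _ _).
  have [l [side [hl eX]]] := mono_side es had.
  pose s : I := (Ordinal hb', Ordinal hc', Ordinal hl, side).
  by rewrite eX; have := row_sub (enum_rank s) Cm; rewrite rowK enum_rankK.
have scale x' P : (vec E P <= V)%MS -> (vec E (cst x' * P) <= V)%MS.
  by rewrite vecZ; apply: scalemx_sub.
have E1 : (4 * N1 <= E)%N by move: hx; rewrite eE2' eE2 /B; clear; lia.
have E2' : (4 * N2 <= E)%N by move: hx; rewrite eE2' eE2 /B; clear; lia.
have E3 : (4 * tau * N3 <= E)%N by move: hx; rewrite eE2' eE2 /B; clear; lia.
have span n P : hom E P -> xylt n P -> (vec E P <= V)%MS.
  apply: (@spanning (fun P => (vec E P <= V)%MS) t kap i j tau N1 N2 N3) => //.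
  - by rewrite vec0 sub0mx.
  - by move=> u v hu hv; rewrite vecD; apply: addmx_sub.
  - by rewrite -eD1 => Q hQ; apply: subM hQ.
  - by rewrite -eD2 => Q hQ; apply: subM hQ.
  - by rewrite -eD3 => Q hQ; apply: subM hQ.
have fullV : (1%:M <= V)%MS.
  apply/row_subP => s; rewrite row1 -(vec_exm S); apply: (span E.+1).
    exact: hom_exm.
  move=> a' b' c' d' cP; have := hom_exm cP; rewrite wdeg_tot => es.
  by rewrite ltnS -es; clear; lia.
have := mxrankS fullV; rewrite mxrank1 => rV.
have rV1 := mxrank_adds_leqif W (Cm + T)%MS.
have rV2 := mxrank_adds_leqif Cm T.
have rC := rank_leq_row Cm.
have rT : (\rank T <= nmono E2 - \rank J)%N.
  by rewrite -mxrank_compl; apply: mxrankM_maxl.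
have rJ2 := rank_leq_col J.
move: rV rV1.1 rV2.1 rC rT rJ2 rU rJ rW; rewrite -/V.
move: (\rank V) (\rank W) (\rank (Cm + T)%MS) (\rank Cm) (\rank T) (\rank J) (\rank U).
by clear; lia.
Qed.

End Gcd.

(** * Coprime extremal forms *)

Section Descent.
Variables (A : idomainType) (phi gam : {poly A}).
Local Notation df := (size phi).-1.
Local Notation dg := (size gam).-1.

(** The hypothesis says deg U + deg psi <= N, so only one product of coefficients reaches position
    [N]. *)
Lemma coefM_top (U psi : {poly A}) N : ((size psi).-1 <= N)%N ->
  (size U + (size psi).-1 <= N.+1)%N -> (U * psi)`_N = U`_(N - (size psi).-1) * lead_coef psi.
Proof.
move=> hN sU; have hi : (N - (size psi).-1 < N.+1)%N by lia.
rewrite coefM (bigD1 (Ordinal hi)) //= big1 ?addr0 ?subKn // => i hne.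
have [lt|] := leqP (size U) i; first by rewrite nth_default // mul0r.
move=> hiU; rewrite [psi`_ _]nth_default ?mulr0 //.
have ne : nat_of_ord i <> (N - (size psi).-1)%N.
  by move=> e; case/eqP: hne; apply: val_inj.
have hiN : (i + (size psi).-1 <= N)%N.
  by rewrite -ltnS; apply: leq_trans sU; rewrite ltn_add2r.
by move: ne hiN hN; case: (size psi) => [|s] /=; lia.
Qed.

Hypothesis syz : forall u v, lead_coef phi * u = lead_coef gam * v ->
  exists q, u = lead_coef gam * q /\ v = lead_coef phi * q.

(** Induction on the excess [n] of the degrees over [e]. A cancellation above [e] is a syzygy of the
    leading coefficients, hence a multiple of the Koszul one, and can be removed; without excess the
    coefficient at [e] gives the claim. *)
Lemma lead_descent_high U V H e : (df + dg <= e)%N ->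
  U * phi + V * gam = H%:P * 'X^e ->
  exists a b, H = a * lead_coef phi + b * lead_coef gam.
Proof.
move=> he e0.
have [n [sU sV]] : exists n, (size U + df <= (e + n).+1)%N /\ (size V + dg <= (e + n).+1)%N.
  by exists (size U + size V + df + dg)%N; split; lia.
elim: n U V e0 sU sV => [|n IH] U V e0 sU sV.
  rewrite addn0 in sU sV.
  have := congr1 (fun p : {poly A} => p`_e) e0.
  rewrite /= coefD (coefM_top _ sU) ?(coefM_top _ sV) ?coefCM ?coefXn ?eqxx ?mulr1; try lia.
  by move=> <-; exists U`_(e - df), V`_(e - dg).
set N := (e + n.+1)%N in sU sV.
have := congr1 (fun p : {poly A} => p`_N) e0.
rewrite /= coefD (coefM_top _ sU) ?(coefM_top _ sV) ?coefCM ?coefXn; try (rewrite /N; lia).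
rewrite (_ : (N == e) = false) ?mulr0; last by rewrite /N; lia.
move/eqP; rewrite addr_eq0 => /eqP h.
have [|q [eu ev]] := @syz U`_(N - df) (- V`_(N - dg)).
  by rewrite mulrC h mulrN mulrC.
(* With this exponent, the multiples of [gam] and [phi] by q X reach exactly the top degrees N - df
   of [U] and N - dg of [V]. The bound on [e] keeps the subtraction from being truncated. *)
pose X := 'X^(N - (df + dg)) : {poly A}.
have cX (psi : {poly A}) i : (q%:P * X * psi)`_i =
    if (i < N - (df + dg))%N then 0 else q * psi`_(i - (N - (df + dg))).
  by rewrite -mulrA coefCM coefXnM; case: ifP; rewrite ?mulr0.
have hNd : (df + dg <= N)%N by rewrite /N; lia.
have [hf hg] : (df <= N)%N /\ (dg <= N)%N by lia.
have P0 (psi : {poly A}) i : ((size psi).-1 < i)%N -> psi`_i = 0.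
  by move=> hi; apply: nth_default; apply: leq_trans (leqSpred _) hi.
have U0 i : (N - df < i)%N -> U`_i = 0.
  move=> hi; apply: nth_default; apply: leq_trans hi.
  by rewrite -subSn // leq_subRL ?(addnC df) //; lia.
have V0 i : (N - dg < i)%N -> V`_i = 0.
  move=> hi; apply: nth_default; apply: leq_trans hi.
  by rewrite -subSn // leq_subRL ?(addnC dg) //; lia.
apply: (IH (U - q%:P * X * gam) (V + q%:P * X * phi)).
- by rewrite -e0; ring.
- have : (size (U - q%:P * X * gam)%R <= N - df)%N.
    apply/leq_sizeP => i hi; rewrite coefB cX ifF; last by lia.
    have [->|ne] := eqVneq i (N - df)%N.
      rewrite eu (_ : N - df - _ = dg)%N; last by lia.
      by rewrite mulrC lead_coefE subrr.
    rewrite U0; last by lia.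
    by rewrite P0 ?mulr0 ?subr0 //; lia.
  by rewrite -(leq_add2r df) => hs; apply: leq_trans hs _; rewrite subnK // /N; lia.
- have : (size (V + q%:P * X * phi)%R <= N - dg)%N.
    apply/leq_sizeP => i hi; rewrite coefD cX ifF; last by lia.
    have [->|ne] := eqVneq i (N - dg)%N.
      rewrite (_ : N - dg - _ = df)%N; last by lia.
      by rewrite [q * _]mulrC -lead_coefE -ev subrr.
    rewrite V0; last by lia.
    by rewrite P0 ?mulr0 ?addr0 //; lia.
  by rewrite -(leq_add2r dg) => hs; apply: leq_trans hs _; rewrite subnK // /N; lia.
Qed.

(** Multiplying the relation by a power of X makes [e] large enough. *)
Lemma lead_descent U V H e : U * phi + V * gam = H%:P * 'X^e ->
  exists a b, H = a * lead_coef phi + b * lead_coef gam.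
Proof.
move=> e0; pose M := (df + dg)%N.
apply: (@lead_descent_high ('X^M * U) ('X^M * V) H (M + e)); first by rewrite leq_addr.
by rewrite exprD mulrCA -e0; ring.
Qed.

End Descent.

(** * Restriction of the extremal forms to the plane, and conclusion *)

Section Final.
Variables (k : fieldType) (S : poly4 k).
Implicit Types P Q : S.
Local Notation hom := (@whomog k S otot).

(** [Gam] turns the membership of a homogeneous [H] into a relation with right-hand side H T^e;
    coprimality supplies the syzygies needed for the descent. *)
Lemma inI_lc o (f g H : S) e : whomog o e H -> g != 0 -> coprime_elts (lc o f) (lc o g) ->
  inI f g H -> inI (lc o f) (lc o g) H.
Proof.
move=> /whomogP hH g0 co [U [V e0]].
have lg0 : lc o g != 0 by rewrite lc_eq0.
apply: (@lead_descent S (Gam S o f) (Gam S o g) _ (Gam S o U) (Gam S o V) H e).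
  move=> u v h; have [q eq] := coprime_syzygy (@poly4_factorial k S) lg0 co h.
  exists q; split=> //; apply: (mulfI lg0); rewrite -[LHS]h eq.
  by rewrite /lc; ring.
by rewrite -hH e0 rmorphD !rmorphM.
Qed.

Definition rho0 : {rmorphism S -> {poly {poly k}}} :=
  ev S (polyC \o polyC) 0 (monoST 1 0) (monoST 0 1) 0.
Definition rho1 : {rmorphism S -> {poly {poly k}}} :=
  ev S (polyC \o polyC) 1 (monoST 1 0) (monoST 0 1) 1.

Lemma rho1_mono t a b c d : rho1 (cst t * mono a b c d) = t%:P%:P * monoST b c.
Proof.
rewrite ev_mono /= !expr1n mul1r mulr1 !monoSTX monoSTM.
by rewrite !mul0n !mul1n addn0.
Qed.

Lemma rho0_mono t a b c d : rho0 (cst t * mono a b c d) =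
  (if (a == 0)%N && (d == 0)%N then t%:P%:P * monoST b c else 0).
Proof.
rewrite ev_mono /= !expr0n !monoSTX.
case: (a == 0)%N; case: (d == 0)%N; rewrite /= ?mul0r ?mulr0 //.
by rewrite mul1r mulr1 monoSTM !mul0n !mul1n addn0.
Qed.

Lemma mono1E a b c d : (mono a b c d : S) = cst 1 * mono a b c d.
Proof. by rewrite rmorph1 mul1r. Qed.

Lemma rho0_bihomog n e1 P : hom n P -> whomog ow1 e1 P ->
  exists al p q, [/\ rho0 P = al%:P%:P * monoST p q, al != 0 -> e1 = (3 * p + q)%N
    & al != 0 -> (p + q)%N = n].
Proof.
(* These values solve p + q = n and 3p + q = e1, so at most one monomial in x and y alone occurs. *)
move=> hn h1; pose p := ((e1 - n) %/ 2)%N; pose q := (n - p)%N.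
suff [al [h2 h3]] : exists al, rho0 P = al%:P%:P * monoST p q /\
    (al != 0 -> e1 = (3 * p + q)%N /\ (p + q)%N = n).
  by exists al, p, q; split=> // /h3[].
apply: (@poly4_supp_ind k S (fun P => exists al, rho0 P = al%:P%:P * monoST p q /\
    (al != 0 -> e1 = (3 * p + q)%N /\ (p + q)%N = n))).
- by exists 0; rewrite rmorph0 !polyC0 mul0r eqxx.
- move=> u v [x [ex hx]] [y [ey hy]]; exists (x + y); split.
    by rewrite rmorphD ex ey !polyCD mulrDl.
  have [->|/hx//] := eqVneq x 0; by rewrite add0r.
move=> a b c d cP; rewrite rho0_mono.
have := hn _ _ _ _ cP; have := h1 _ _ _ _ cP; rewrite wdeg_tot wdeg_ow1 /bideg1 => e1E nE.
case: andP => [[/eqP a0 /eqP d0]|_]; last by exists 0; rewrite !polyC0 mul0r eqxx.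
exists (cf P a b c d).
have eb : b = p by rewrite /p; lia.
have ec : c = q by rewrite /q -eb; lia.
by rewrite -eb -ec; split=> // _; lia.
Qed.

(** For w^a x^b y^c z^d the two degrees give a = 2c + 3d. Hence either the monomial is x^n, or a >=
    2 and b + c <= n - 2. *)
Lemma rho1_x n P : hom n P -> whomog ow1 (3 * n) P ->
  exists al, rho0 P = al%:P%:P * monoST n 0 /\
    tdeg_lt n.-1 (rho1 P - al%:P%:P * monoST n 0).
Proof.
move=> hn h1; apply: (@poly4_supp_ind k S (fun P => exists al,
  rho0 P = al%:P%:P * monoST n 0 /\ tdeg_lt n.-1 (rho1 P - al%:P%:P * monoST n 0))).
- by exists 0; rewrite !rmorph0 !mul0r subr0; split=> // p q _; rewrite !coef0.
- move=> u v [x [ex hx]] [y [ey hy]]; exists (x + y); split.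
    by rewrite rmorphD ex ey !polyCD mulrDl.
  have := tdeg_ltD hx hy; rewrite rmorphD !polyCD; congr tdeg_lt; ring.
move=> a b c d cP; rewrite rho0_mono rho1_mono.
have := hn _ _ _ _ cP; have := h1 _ _ _ _ cP; rewrite wdeg_tot wdeg_ow1 /bideg1 => e1E nE.
have [a0|a0] := eqVneq a 0%N.
  have [-> -> ->] : [/\ b = n, c = 0 & d = 0]%N by split; lia.
  exists (cf P a n 0 0); rewrite a0 eqxx subrr; split=> // p q _; by rewrite !coef0.
exists 0; rewrite !polyC0 !mul0r subr0; split=> //.
apply: tdeg_lt_cstM; apply: tdeg_lt_monoST; lia.
Qed.

(** Here the degrees give d = 3a + 2b, so a monomial other than y^n has d >= 2. *)
Lemma rho1_y n P : hom n P -> whomog ow1 n P ->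
  exists al, rho0 P = al%:P%:P * monoST 0 n /\
    tdeg_lt n.-1 (rho1 P - al%:P%:P * monoST 0 n).
Proof.
move=> hn h1; apply: (@poly4_supp_ind k S (fun P => exists al,
  rho0 P = al%:P%:P * monoST 0 n /\ tdeg_lt n.-1 (rho1 P - al%:P%:P * monoST 0 n))).
- by exists 0; rewrite !rmorph0 !mul0r subr0; split=> // p q _; rewrite !coef0.
- move=> u v [x [ex hx]] [y [ey hy]]; exists (x + y); split.
    by rewrite rmorphD ex ey !polyCD mulrDl.
  have := tdeg_ltD hx hy; rewrite rmorphD !polyCD; congr tdeg_lt; ring.
move=> a b c d cP; rewrite rho0_mono rho1_mono.
have := hn _ _ _ _ cP; have := h1 _ _ _ _ cP; rewrite wdeg_tot wdeg_ow1 /bideg1 => e1E nE.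
have [d0|d0] := eqVneq d 0%N.
  have [-> -> ->] : [/\ a = 0, b = 0 & c = n]%N by split; lia.
  exists (cf P 0 0 n d); rewrite d0 subrr; split=> // p q _; by rewrite !coef0.
exists 0; rewrite !polyC0 !mul0r subr0 andbF; split=> //.
apply: tdeg_lt_cstM; apply: tdeg_lt_monoST; lia.
Qed.

(** Setting w = z = 1 turns xy - wz into xy - 1; [F] and [G] are made monic in x^n and y^m by
    dividing by [al] and [be]. *)
Lemma bihomog_pair_xy F G n m al be N : (0 < n)%N -> (0 < m)%N -> hom n F -> hom m G ->
  whomog ow1 (3 * n) F -> whomog ow1 m G ->
  rho0 F = al%:P%:P * monoST n 0 -> rho0 G = be%:P%:P * monoST 0 m -> al != 0 -> be != 0 ->
  inI F G ((mono 0 1 1 0 - mono 1 0 0 1) ^+ N) -> (n * m)%:R = 0 :> k.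
Proof.
move=> n0 m0 hF hG oF oG rF rG al0 be0 [A [B e]].
have cancel (x : k) u : x != 0 -> x^-1%:P%:P * (x%:P%:P * u) = u :> {poly {poly k}}.
  by move=> x0; rewrite mulrA -!polyCM mulVf // !polyC1 mul1r.
have [al' [rF' tF]] := rho1_x hF oF; have [be' [rG' tG]] := rho1_y hG oG.
have eal : al' = al.
  have e1 x : (x%:P%:P * monoST n 0 : {poly {poly k}})`_n`_0 = x.
    by rewrite coef_cstM coef_monoST !eqxx mulr1.
  by rewrite -(e1 al') -rF' rF e1.
have ebe : be' = be.
  have e1 x : (x%:P%:P * monoST 0 m : {poly {poly k}})`_0`_m = x.
    by rewrite coef_cstM coef_monoST !eqxx mulr1.
  by rewrite -(e1 be') -rG' rG e1.
rewrite eal in tF; rewrite ebe in tG.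
pose F1 := al^-1%:P%:P * rho1 F; pose G1 := be^-1%:P%:P * rho1 G.
have eF : F1 = monoST n 0 + al^-1%:P%:P * (rho1 F - al%:P%:P * monoST n 0).
  by rewrite mulrBr cancel // addrC subrK.
have eG : G1 = monoST 0 m + be^-1%:P%:P * (rho1 G - be%:P%:P * monoST 0 m).
  by rewrite mulrBr cancel // addrC subrK.
apply: (@xy_nilpotent_char k n m F1 G1 _ _ n0 m0 eF eG (tdeg_lt_cstM _ tF) (tdeg_lt_cstM _ tG) N).
exists (rho1 A * al%:P%:P), (rho1 B * be%:P%:P).
have -> : rho1 A * al%:P%:P * F1 + rho1 B * be%:P%:P * G1 = rho1 (A * F + B * G).
  rewrite rmorphD !rmorphM /F1 /G1 -!mulrA; congr (_ * _ + _ * _).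
    by rewrite mulrCA cancel.
  by rewrite mulrCA cancel.
rewrite -e rmorphXn rmorphB mono1E [mono 1 0 0 1]mono1E.
by rewrite !rho1_mono !polyC1 !mul1r /monoST !expr0 !mulr1.
Qed.

(** Modulo w and z the first two memberships produce powers of x and of y, so one form restricts to
    a pure power of x and one to a pure power of y. Positive degree prevents a single form from
    doing both. *)
Lemma bihomog_pair F G n m e e' N1 N2 N3 : (0 < n)%N -> (0 < m)%N -> hom n F -> hom m G ->
  whomog ow1 e F -> whomog ow1 e' G ->
  inI F G ((mono 0 4 0 0 - mono 3 0 0 1) ^+ N1) ->
  inI F G ((mono 0 0 4 0 - mono 1 0 0 3) ^+ N2) ->
  inI F G ((mono 0 1 1 0 - mono 1 0 0 1) ^+ N3) -> (n * m)%:R = 0 :> k.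
Proof.
move=> n0 m0 hF hG oF oG i1 i2 i3.
have [al [p [q [rF eF pqF]]]] := rho0_bihomog hF oF.
have [be [p' [q' [rG eG pqG]]]] := rho0_bihomog hG oG.
have coefI (P Q : {poly {poly k}}) i j :
    (P * ((al%:P%:P) * monoST p q) + Q * (be%:P%:P * monoST p' q'))`_i`_j != 0 ->
    (al != 0 /\ (p <= i)%N /\ (q <= j)%N) \/ (be != 0 /\ (p' <= i)%N /\ (q' <= j)%N).
  rewrite (_ : P * _ + _ = al%:P%:P * (monoST p q * P) + be%:P%:P * (monoST p' q' * Q));
    last by ring.
  rewrite !coefD !coef_cstM !coef_monoSTM.
  have [->|al0] := eqVneq al 0; have [->|be0] := eqVneq be 0; rewrite ?mul0r ?addr0 ?add0r ?eqxx //.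
  - by case: andP => [[h1 h2] _|]; [right|rewrite mulr0 eqxx].
  - by case: andP => [[h1 h2] _|]; [left|rewrite mulr0 eqxx].
  case: andP => [[h1 h2] _|_]; first by left.
  by case: andP => [[h1 h2] _|]; [right|rewrite !mulr0 addr0 eqxx].
have hx : (al != 0 /\ q = 0%N) \/ (be != 0 /\ q' = 0%N).
  case: i1 => A [B /(congr1 rho0)].
  rewrite rmorphXn rmorphB mono1E [mono 3 0 0 1]mono1E !rho0_mono /=.
  rewrite subr0 !polyC1 mul1r monoSTX rmorphD !rmorphM rF rG.
  move=> e1; have := coef_monoST k (4 * N1) (0 * N1) (4 * N1) (0 * N1).
  rewrite e1 !eqxx mul0n => {}e1.
  have [|[h1 [_ h2]]|[h1 [_ h2]]] := coefI (rho0 A) (rho0 B) (4 * N1)%N 0%N.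
  - by rewrite e1 oner_neq0.
  - by left; split=> //; lia.
  - by right; split=> //; lia.
have hy : (al != 0 /\ p = 0%N) \/ (be != 0 /\ p' = 0%N).
  case: i2 => A [B /(congr1 rho0)].
  rewrite rmorphXn rmorphB mono1E [mono 1 0 0 3]mono1E !rho0_mono /=.
  rewrite subr0 !polyC1 mul1r monoSTX rmorphD !rmorphM rF rG.
  move=> e1; have := coef_monoST k (0 * N2) (4 * N2) (0 * N2) (4 * N2).
  rewrite e1 !eqxx mul0n => {}e1.
  have [|[h1 [h2 _]]|[h1 [h2 _]]] := coefI (rho0 A) (rho0 B) 0%N (4 * N2)%N.
  - by rewrite e1 oner_neq0.
  - by left; split=> //; lia.
  - by right; split=> //; lia.
case: hx => [[al0 q0]|[be0 q0]]; case: hy => [[al0' p0]|[be0' p0]].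
- by have := pqF al0; lia.
- have en := pqF al0; have em := pqG be0'.
  have ep : p = n by lia.
  have eq' : q' = m by lia.
  rewrite ep q0 in rF eF; rewrite p0 eq' in rG eG.
  rewrite (eF al0) addn0 in oF; rewrite (eG be0') in oG.
  exact: (bihomog_pair_xy n0 m0 hF hG oF oG rF rG al0 be0' i3).
- have en := pqF al0'; have em := pqG be0.
  have ep : p' = m by lia.
  have eq : q = n by lia.
  rewrite p0 eq in rF eF; rewrite ep q0 in rG eG.
  rewrite (eF al0') in oF; rewrite (eG be0) addn0 in oG.
  rewrite mulnC; apply: (bihomog_pair_xy m0 n0 hG hF oG oF rG rF be0 al0' (N := N3)).
  by case: i3 => A [B ->]; exists B, A; rewrite addrC.
- by have := pqG be0; lia.
Qed.

Lemma hom0_cst P : hom 0 P -> exists c, P = cst c.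
Proof.
move=> h; apply: (@poly4_supp_ind k S (fun P => exists c, P = cst c)).
- by exists 0; rewrite rmorph0.
- by move=> u v [x ->] [y ->]; exists (x + y); rewrite rmorphD.
move=> a b c d cP; exists (cf P a b c d); have := h _ _ _ _ cP; rewrite wdeg_tot => e.
have [-> -> -> ->] : [/\ a = 0, b = 0, c = 0 & d = 0]%N by split; lia.
by rewrite mono0 mulr1.
Qed.

Lemma par_cst c : par S (cst c) = c%:P%:P.
Proof. by rewrite -[cst c]mulr1 -mono0 par_mono /bideg1 /bideg2 /monoST !expr0 !mulr1. Qed.

Lemma hom_par_gt0 n P : hom n P -> P != 0 -> par S P = 0 -> (0 < n)%N.
Proof.
case: n => // /hom0_cst[c ->] c0; rewrite par_cst => /eqP.
rewrite !polyC_eq0 => /eqP e; by rewrite e rmorph0 eqxx in c0.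
Qed.

Lemma par_mono1 a b c d : par S (mono a b c d) = monoST (bideg1 a b c d) (bideg2 a b c d).
Proof. by rewrite mono1E par_mono !polyC1 mul1r. Qed.

Theorem gcd_lc_in_p o (f g t : S) d1 d2 : [pchar k] =i pred0 -> o = ow1 \/ o = ow2 ->
  hom d1 f -> hom d2 g -> f != 0 -> g != 0 -> par S f = 0 -> par S g = 0 ->
  (forall h, par S h = 0 -> exists N, inI f g (h ^+ N)) ->
  divides t (lc o f) -> divides t (lc o g) ->
  (forall u, divides u (lc o f) -> divides u (lc o g) -> divides u t) ->
  par S t = 0.
Proof.
move=> char0 ho hf hg f0 g0 pf pg rad [a ea] [b eb] gcd_t.
apply/eqP; apply: contraT => pt.
have F0 : t * a != 0 by rewrite -ea lc_eq0.
have G0 : t * b != 0 by rewrite -eb lc_eq0.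
have t0 : t != 0 by move: F0; rewrite mulf_eq0 negb_or => /andP[].
have hF : hom d1 (lc o f) by apply: whomog_hcomp_pres.
have hG : hom d2 (lc o g) by apply: whomog_hcomp_pres.
have oF : whomog o (size (Gam S o f)).-1 (lc o f) by apply: whomog_hcomp.
have oG : whomog o (size (Gam S o g)).-1 (lc o g) by apply: whomog_hcomp.
have [tau ht] : exists tau, hom tau t.
  by apply: (@whomog_factor _ _ otot d1 t a); rewrite -ea // lc_eq0.
have [al ha] : exists al, hom al a.
  by apply: (@whomog_factor _ _ otot d1 a t); rewrite mulrC -ea // lc_eq0.
have [be hb] : exists be, hom be b.
  by apply: (@whomog_factor _ _ otot d2 b t); rewrite mulrC -eb // lc_eq0.
have [et ot] : exists et, whomog o et t.
  by apply: (@whomog_factor _ _ o _ t a); rewrite -ea ?lc_eq0 //; apply: oF.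
have ed1 : d1 = (tau + al)%N.
  by apply: (@whomog_uniq _ _ otot _ _ (t * a)) F0; [rewrite -ea|apply: whomogM].
have ed2 : d2 = (tau + be)%N.
  by apply: (@whomog_uniq _ _ otot _ _ (t * b)) G0; [rewrite -eb|apply: whomogM].
have d10 : (0 < d1)%N := hom_par_gt0 hf f0 pf.
have d20 : (0 < d2)%N := hom_par_gt0 hg g0 pg.
have co : coprime_elts a b.
  move=> c [a' ea'] [b' eb'].
  have [|| q eq] := gcd_t (t * c).
  - by exists a'; rewrite ea ea' mulrA.
  - by exists b'; rewrite eb eb' mulrA.
  apply/unitrPr; exists q; apply: (mulfI t0).
  by rewrite mulrA -eq mulr1.
have [e1 [e2 [ot1 ot2]]] := bihomog ho ht ot.
have [kap ekap] := par_bihomog ot1 ot2.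
have kap0 : kap != 0.
  by apply: contraNneq pt => k0; rewrite ekap k0 !polyC0 mul0r.
have e12 : (e1 + e2 = 4 * tau)%N.
  have [a' [b' [c' [d' ct]]]] := cf_neq0 t0.
  rewrite -(ot1 _ _ _ _ ct) -(ot2 _ _ _ _ ct) -(ht _ _ _ _ ct).
  by rewrite wdeg_ow1 wdeg_ow2 wdeg_tot bideg_sum.
pose q1 := mono 0 4 0 0 - mono 3 0 0 1 : S.
pose q2 := mono 0 0 4 0 - mono 1 0 0 3 : S.
pose q3 := mono 0 1 1 0 - mono 1 0 0 1 : S.
(* The image of [t] is kap s^e1 t^e2, with the curve parameters s and t; its fourth power is the
   image of kap^4 w^e1 z^e2, so [h] lies in the prime ideal. *)
pose h := t ^+ 4 - cst (kap ^+ 4) * mono e1 0 0 e2.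
have [N1 i1] : exists N, inI f g (q1 ^+ N).
  by apply: rad; rewrite /q1 rmorphB !par_mono1 subrr.
have [N2 i2] : exists N, inI f g (q2 ^+ N).
  by apply: rad; rewrite /q2 rmorphB !par_mono1 subrr.
have [N3 i3] : exists N, inI f g (q3 ^+ N).
  by apply: rad; rewrite /q3 rmorphB !par_mono1 subrr.
have [N4 i4] : exists N, inI f g (h ^+ N).
  apply: rad; rewrite /h rmorphB /= par_mono [par S (t ^+ 4)]rmorphXn /= ekap exprMn monoSTX.
  rewrite -!polyC_exp /bideg1 /bideg2 !muln0 !addn0 !add0n.
  by rewrite [(e1 * 4)%N]mulnC [(e2 * 4)%N]mulnC subrr.
have [eh oh] : exists eh, whomog o eh h.
  exists (et * 4)%N; apply: whomogD; first exact: whomogX.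
  apply: whomogN; rewrite -[(et * 4)%N]add0n; apply: whomogM; first exact: whomog_cst.
  rewrite (_ : et * 4 = wdeg o e1 0 0 e2)%N; first exact: whomog_mono.
  case: ho ot => -> ot; rewrite /wdeg /=.
    by rewrite (whomog_uniq ot ot1 t0); lia.
  by rewrite (whomog_uniq ot ot2 t0); lia.
have tau0 : tau = 0%N.
  exact: (gcd_degree0 hf hg d10 d20 f0 g0 ea eb ht ha hb ed1 ed2 co ho oh
    (expf_neq0 4 kap0) e12 i1 i2 i4).
have [c ec] : exists c, t = cst c by apply: hom0_cst; rewrite -tau0.
have ut : t \is a GRing.unit.
  have c0 : c != 0 by apply: contraNneq t0 => c0; rewrite ec c0 rmorph0.
  by rewrite ec; apply: rmorph_unit; rewrite unitfE.
have coFG : coprime_elts (lc o f) (lc o g).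
  move=> u uF uG; have [v ev] := gcd_t u uF uG.
  by move: ut; rewrite ev unitrM => /andP[].
have bih := bihomog ho.
have [e3 [_ [oF1 _]]] := bih _ _ _ _ _ hF oF.
have [e4 [_ [oG1 _]]] := bih _ _ _ _ _ hG oG.
(* The binomials are homogeneous for [o], so their powers pass from (f, g) to the ideal of the now
   coprime leading forms. *)
have q_lc N (m1 m2 : nat * nat * nat * nat) :
    let mm (m : nat * nat * nat * nat) : S := mono m.1.1.1 m.1.1.2 m.1.2 m.2 in
    wdeg o m1.1.1.1 m1.1.1.2 m1.1.2 m1.2 = wdeg o m2.1.1.1 m2.1.1.2 m2.1.2 m2.2 ->
    inI f g ((mm m1 - mm m2) ^+ N) -> inI (lc o f) (lc o g) ((mm m1 - mm m2) ^+ N).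
  move=> mm e; apply: (inI_lc _ g0 coFG (e := (wdeg o m1.1.1.1 m1.1.1.2 m1.1.2 m1.2 * N)%N)).
  apply: whomogX; apply: whomogD; first exact: whomog_mono.
  by rewrite e; apply: whomogN; apply: whomog_mono.
have := bihomog_pair d10 d20 hF hG oF1 oG1
  (q_lc N1 (0, 4, 0, 0)%N (3, 0, 0, 1)%N _ i1)
  (q_lc N2 (0, 0, 4, 0)%N (1, 0, 0, 3)%N _ i2)
  (q_lc N3 (0, 1, 1, 0)%N (1, 0, 0, 1)%N _ i3).
move/(_ _ _ _)/eqP.
have /pcharf0P -> := char0.
rewrite muln_eq0 => H.
have : (d1 == 0)%N || (d2 == 0)%N.
  by apply: H; case: ho => ->.
lia.
Qed.

End Final.

(** * The nested polynomial ring *)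

Section Instance.
Variable k : fieldType.
Implicit Types P Q : R4 k.

Definition cst4 (c : k) : R4 k := c%:P%:P%:P%:P.
HB.instance Definition _ := GRing.RMorphism.copy cst4
  (polyC \o (polyC \o (polyC \o (polyC : k -> {poly k})))).

Definition mono4 (a b c d : nat) : R4 k :=
  'X^a * ('X^b)%:P * ('X^c)%:P%:P * ('X^d)%:P%:P%:P.

Lemma mono4M a b c d a' b' c' d' :
  mono4 a b c d * mono4 a' b' c' d' = mono4 (a + a') (b + b') (c + c') (d + d').
Proof.
have aux (A : comNzRingType) (x y z t x' y' z' t' : A) :
    x * y * z * t * (x' * y' * z' * t') = x * x' * (y * y') * (z * z') * (t * t') by ring.
by rewrite /mono4 !exprD !polyCM aux.
Qed.

Lemma mono40 : mono4 0 0 0 0 = 1.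
Proof. by rewrite /mono4 !expr0 !polyC1 !mulr1. Qed.

Lemma R4_sum P : P = \sum_(a < size P) \sum_(b < size P`_a) \sum_(c < size P`_a`_b)
   \sum_(d < size P`_a`_b`_c) cst4 (coef4 P a b c d) * mono4 a b c d.
Proof.
rewrite -{1}[P]coefK poly_def; apply: eq_bigr => a _.
rewrite -mul_polyC -{1}[P`_a]coefK poly_def rmorph_sum /= mulr_suml; apply: eq_bigr => b _.
rewrite -mul_polyC -{1}[P`_a`_b]coefK poly_def !rmorph_sum /= !mulr_suml rmorph_sum /= mulr_suml.
apply: eq_bigr => c _.
rewrite -mul_polyC -{1}[P`_a`_b`_c]coefK poly_def !(mulr_suml, rmorph_sum) /=.
apply: eq_bigr => d _; rewrite -mul_polyC !polyCM /cst4 /mono4 /coef4.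
ring.
Qed.

Lemma R4_supp_ind (K : R4 k -> Prop) P :
  K 0 -> (forall u v, K u -> K v -> K (u + v)) ->
  (forall a b c d, coef4 P a b c d != 0 -> K (cst4 (coef4 P a b c d) * mono4 a b c d)) ->
  K P.
Proof.
move=> K0 KD KP; rewrite [P]R4_sum.
do 4![apply: (big_ind K) => // ? _].
set x := coef4 _ _ _ _ _; have [->|] := eqVneq x 0; last exact: KP.
by rewrite rmorph0 mul0r.
Qed.

Lemma coef4D P Q a b c d : coef4 (P + Q) a b c d = coef4 P a b c d + coef4 Q a b c d.
Proof. by rewrite /coef4 !coefD. Qed.

Lemma coef4_cstM t P a b c d : coef4 (cst4 t * P) a b c d = t * coef4 P a b c d.
Proof. by rewrite /coef4 /cst4 !coefCM. Qed.

Lemma coef4_mono a b c d a' b' c' d' :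
  coef4 (mono4 a b c d) a' b' c' d' =
  ((a' == a) && (b' == b) && (c' == c) && (d' == d))%:R.
Proof.
rewrite /coef4 /mono4 !coefMC !coefXn.
case: eqP => _ /=; last by rewrite !(mul0r, coef0).
rewrite mul1r coefXn; case: eqP => _ /=; last by rewrite !(mul0r, coef0).
rewrite mul1r coefXn; case: eqP => _ /=; last by rewrite !(mul0r, coef0).
by rewrite mul1r coefXn.
Qed.

(** Evaluation of one variable over a morphism of the coefficients, to be iterated along the
    nesting. *)
Definition ev1 (A B : comNzRingType) (f : {rmorphism A -> B}) (u : B) : {poly A} -> B :=
  horner_eval u \o map_poly f.
Arguments ev1 : simpl never.

HB.instance Definition _ A B f u := GRing.RMorphism.on (@ev1 A B f u).

Lemma ev1C (A B : comNzRingType) (f : {rmorphism A -> B}) u v : ev1 f u v%:P = f v.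
Proof. by rewrite /ev1 /= map_polyC /= /horner_eval hornerC. Qed.

Lemma ev1Xn (A B : comNzRingType) (f : {rmorphism A -> B}) u n : ev1 f u 'X^n = u ^+ n.
Proof. by rewrite /ev1 /= map_polyXn /horner_eval hornerXn. Qed.

Definition ev4 (B : comNzRingType) (i : {rmorphism k -> B}) (bw bx by_ bz : B)
   : R4 k -> B :=
  ev1 (ev1 (ev1 (ev1 i bz) by_) bx) bw.

HB.instance Definition _ B i bw bx by_ bz :=
  GRing.RMorphism.on (@ev4 B i bw bx by_ bz).

Lemma ev4_mono (B : comNzRingType) (i : {rmorphism k -> B}) (bw bx by_ bz : B) t a b c d :
  ev4 i bw bx by_ bz (cst4 t * mono4 a b c d)
    = i t * (bw ^+ a * bx ^+ b * by_ ^+ c * bz ^+ d).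
Proof.
rewrite /mono4 /cst4 !rmorphM /= /ev4.
by do 4![rewrite ?(ev1C, ev1Xn) /=].
Qed.

Definition poly4_R4 : poly4 k :=
  @Poly4 k (R4 k : idomainType) cst4 mono4 coef4 ev4 mono40 mono4M coef4D coef4_cstM
    coef4_mono R4_supp_ind ev4_mono (@factorial_R4 k).

Lemma param_par P : param P = par poly4_R4 P.
Proof.
rewrite [in RHS](R4_sum P) /param !rmorph_sum; apply: eq_bigr => a _.
rewrite rmorph_sum; apply: eq_bigr => b _; rewrite rmorph_sum; apply: eq_bigr => c _.
rewrite rmorph_sum; apply: eq_bigr => d _.
exact/esym/(@par_mono k poly4_R4).
Qed.

Lemma coef_bicomp i j P a b c d : coef4 (bicomp i j P) a b c d =
  if (bideg1 a b c d == i) && (bideg2 a b c d == j) then coef4 P a b c d else 0.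
Proof.
rewrite /coef4 /bicomp coef_poly; case: ltnP => h; last first.
  by rewrite (nth_default 0 h) !coef0 if_same.
rewrite coef_poly; case: ltnP => h1; last first.
  by rewrite (nth_default 0 h1) !coef0 if_same.
rewrite coef_poly; case: ltnP => h2; last first.
  by rewrite (nth_default 0 h2) !coef0 if_same.
rewrite coef_poly; case: ltnP => h3 //.
by rewrite (nth_default 0 h3) !if_same.
Qed.

End Instance.

Theorem theorem1 (k : closedFieldType) (hchar : [pchar k] =i pred0)
  (f g : R4 k) (d1 d2 : nat)
  (hfp : in_p f) (hgp : in_p g)
  (hfh : homog d1 f) (hgh : homog d2 g)
  (hrad : radical_eq_p f g)
  (imin imax jmin jmax : nat)
  (himin : is_imin d1 f imin) (himax : is_imax d1 f imax)
  (hjmin : is_imin d2 g jmin) (hjmax : is_imax d2 g jmax)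
  (tmin tmax : R4 k)
  (htmin : is_gcdR tmin (bicomp imin (4 * d1 - imin) f)
                        (bicomp jmin (4 * d2 - jmin) g))
  (htmax : is_gcdR tmax (bicomp imax (4 * d1 - imax) f)
                        (bicomp jmax (4 * d2 - jmax) g)) :
  in_p tmin /\ in_p tmax.
Proof.
pose S := poly4_R4 k.
have homS n (P : S) : homog n P -> whomog otot n P.
  by move=> h a b c d /h <-; rewrite wdeg_tot.
have hf := homS _ _ hfh; have hg := homS _ _ hgh.
have neq0 i j (P : R4 k) : bicomp i j P != 0 -> P != 0.
  apply: contraNneq => ->; apply/eqP; apply: (@cfP k S) => a b c d.
  by rewrite (@cf0 k S) [LHS]coef_bicomp /coef4 !coef0 if_same.
have f0 : f != 0 := neq0 _ _ _ himin.1.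
have g0 : g != 0 := neq0 _ _ _ hjmin.1.
have pf : par S f = 0 by rewrite -param_par.
have pg : par S g = 0 by rewrite -param_par.
have rad (h : S) : par S h = 0 -> exists N, inI (f : S) (g : S) (h ^+ N).
  by rewrite -param_par => /hrad.
have main o (t : S) : o = ow1 \/ o = ow2 -> is_gcdR t (lc o (f : S)) (lc o (g : S)) ->
    in_p t.
  move=> ho [tf tg gcd_t]; rewrite /in_p param_par.
  exact: (gcd_lc_in_p hchar ho hf hg f0 g0 pf pg rad tf tg gcd_t).
split.
  (* The least first bidegree is the greatest second one, so the minimal components are leading
     forms for [ow2]. *)
  apply: (main ow2); first by right.
  by rewrite -(@imin_lc k S bicomp (@coef_bicomp k) _ _ _ hf himin)
  -(@imin_lc k S bicomp (@coef_bicomp k) _ _ _ hg hjmin).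
apply: (main ow1); first by left.
by rewrite -(@imax_lc k S bicomp (@coef_bicomp k) _ _ _ hf himax)
  -(@imax_lc k S bicomp (@coef_bicomp k) _ _ _ hg hjmax).
Qed.
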